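(* Let $\Lambda$ be the formal spectrum of a complete local noetherian $\mathbb{C}$-algebra with residue field $\mathbb{C}$. For $i=1,\dots,k$, let $\mathcal{E}_i=\{E_{i,\lambda}\}_{\lambda\in\Lambda}$ be a family of $w_i$-contact equations over $\Lambda$ and $\mathcal{C}_i$ the family of curves defined by $\mathcal{E}_i$, with central fiber $C_i$. For $j=1,\dots,l$, let $\mathcal{E}'_j=\{E'_{j,\lambda}\}_{\lambda\in\Lambda}$ be a family of equations over $\Lambda$ with $E'_{j,0}(0,0)=0$ and $\mathcal{C}'_j$ the family of curves defined by $\mathcal{E}'_j$, with central fiber $C'_j$. Let $I_i\subset\mathcal{O}$ (resp. $I'_j\subset\mathcal{O}$) be the ideal of a length $d_i$ (resp. $d'_j$) subscheme of $C_i$ (resp. $C'_j$), and write $[\tilde I_i]=L^{d_i}_{\mathcal{E}_i}([I_i])$ and $[\tilde I'_j]=L'^{\,d'_j}_{\mathcal{E}'_j}([I'_j])$. Consider the morphism $$L:=\prod_{i=1}^k L_{\mathcal{E}_i,I_i}\times\prod_{j=1}^l L'_{\mathcal{E}'_j,I'_j}:\ \mathcal{H}^{\hat{\mathbb{A}}^2_\Lambda/\Lambda}_{I_1}\times_\Lambda\dots\times_\Lambda\mathcal{H}^{\hat{\mathbb{A}}^2_\Lambda/\Lambda}_{I'_l}\to\mathcal{H}^{\hat{\mathbb{A}}^3}_{\tilde I_1}\times\dots\times\mathcal{H}^{\hat{\mathbb{A}}^3}_{\tilde I'_l}$$ (the products running over all $I_1,\dots,I_k,I'_1,\dots,I'_l$).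 (1) The equality $$L^{-1}\left(\prod_{i=1}^k\mathcal{H}^{S_{w_i-1}}_{\tilde I_i}\times\prod_{j=1}^l\mathcal{H}^{S'}_{\tilde I'_j}\right)=\mathcal{H}^{\mathcal{C}_1/\Lambda}_{I_1}\times_\Lambda\dots\times_\Lambda\mathcal{H}^{\mathcal{C}'_l/\Lambda}_{I'_l}$$ holds as formal subschemes of $\mathcal{H}^{\hat{\mathbb{A}}^2_\Lambda/\Lambda}_{I_1}\times_\Lambda\dots\times_\Lambda\mathcal{H}^{\hat{\mathbb{A}}^2_\Lambda/\Lambda}_{I'_l}$, where $S_n\subset\hat{\mathbb{A}}^3$ (resp. $S'\subset\hat{\mathbb{A}}^3$) is defined by $yz+x^{n+1}=0$ (resp. $z=0$). (2) Assume that $\Lambda$ is regular and that the map $$(\Phi_{\mathcal{E}_1,I_1},\dots,\Phi_{\mathcal{E}_k,I_k},\Delta_{\mathcal{E}'_1,I'_1},\dots,\Delta_{\mathcal{E}'_l,I'_l}):T_0\Lambda\to\mathcal{O}/I_1\times\dots\times\mathcal{O}/I_k\times\mathcal{O}/I'_1\times\dots\times\mathcal{O}/I'_l$$ is surjective. Then $L$ is smooth of relative dimension $\dim\Lambda-\sum_{i=1}^kd_i-\sum_{j=1}^ld'_j$ at $([I_1],\dots,[I'_l])$, and therefore induces a smooth morphism $$\mathcal{H}^{\mathcal{C}_1/\Lambda}_{I_1}\times_\Lambda\dots\times_\Lambda\mathcal{H}^{\mathcal{C}'_l/\Lambda}_{I'_l}\to\prod_{i=1}^k\mathcal{H}^{S_{w_i-1}}_{\tilde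 I_i}\times\prod_{j=1}^l\mathcal{H}^{S'}_{\tilde I'_j}$$ of relative dimension $\dim\Lambda-\sum_{i=1}^kd_i-\sum_{j=1}^ld'_j$.
   Context: Notation. $\mathcal{O}=\mathbb{C}[[x,y]]$; $\hat{\mathbb{A}}^2$ is the formal spectrum of $\mathcal{O}$; $\hat{\mathbb{A}}^2_\Lambda=\hat{\mathbb{A}}^2\times\Lambda$; $D=(y=0)\subset\hat{\mathbb{A}}^2$; $0$ is the closed point of $\Lambda$ and $\lambda$ symbolically denotes coordinates on $\Lambda$. A family of equations over $\Lambda$ is a section $\mathcal{E}=\{E_\lambda(x,y)\}_{\lambda\in\Lambda}$ of $\mathcal{O}_{\hat{\mathbb{A}}^2\times\Lambda}$, with restriction $E_0(x,y)$ to the closed fiber; the family of curves it defines is the closed formal subscheme $\mathcal{E}=0$ of $\hat{\mathbb{A}}^2\times\Lambda$. A family of $w$-contact equations over $\Lambda$ ($w\geq1$) is a section $\mathcal{E}$ of $\mathcal{O}_{\hat{\mathbb{A}}^2\times\Lambda}$ with $\mathcal{E}|_{D\times\Lambda}=x^wu$ for a unit $u\in\mathcal{O}_{D\times\Lambda}^\times$; it is written uniquely as $E_\lambda(x,y)=yf_\lambda(x,y)+x^wg_\lambda(x)$ ($g_\lambda$ a unit). Formal Hilbert schemes. Let $R$ be a complete local noetherian $\mathbb{C}$-algebra with residue field $\mathbb{C}$ and $\Lambda$ its formal spectrum. For a (formal) scheme $Y$ over $\Lambda$ and a finite-length closed subscheme $Z\subset Y_0$ (with ideal $I$), $\mathcal{H}^{Y/\Lambda}_Z=\mathcal{H}^{Y/\Lambda}_I$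 is the formal spectrum of the complete local ring pro-representing the functor sending a local artinian $R$-algebra $A$ with residue field $\mathbb{C}$ to the set of closed subschemes $\tilde Z\subset Y\otimes_RA$ flat over $A$ with $\tilde Z_0=Z$. Equivalently it is the completion of the relative Hilbert scheme at $[Z]$. When $R=\mathbb{C}$ it is written $\mathcal{H}^Y_Z$ or $\mathcal{H}^Y_I$. The maps $L$. For a family $\mathcal{E}$ of $w$-contact equations over $\Lambda$, written uniquely as $E_\lambda(x,y)=yf_\lambda(x,y)+x^wg_\lambda(x)$ with $g_\lambda$ a unit, let $\mathcal{S}_{\mathcal{E}}\subset\hat{\mathbb{A}}^3_\Lambda$ be the closed formal subscheme $z-g_\lambda(x)^{-1}f_\lambda(x,y)=0$, where $\hat{\mathbb{A}}^3$ is the completion of $\mathbb{A}^3$ (coordinates $x,y,z$) at $x=y=0$, $z=g_0(0)^{-1}f_0(0,0)$. The projection $\mathcal{S}_{\mathcal{E}}\to\hat{\mathbb{A}}^2_\Lambda$ is an isomorphism, and $L^d_{\mathcal{E}}:\mathrm{Hilb}^d(\hat{\mathbb{A}}^2_\Lambda/\Lambda)\to\mathrm{Hilb}^d(\hat{\mathbb{A}}^3)$ is the composite $\mathrm{Hilb}^d(\hat{\mathbb{A}}^2_\Lambda/\Lambda)\cong\mathrm{Hilb}^d(\mathcal{S}_{\mathcal{E}}/\Lambda)\hookrightarrow\mathrm{Hilb}^d(\hat{\mathbb{A}}^3_\Lambda/\Lambda)\to\mathrm{Hilb}^d(\hat{\mathbb{A}}^3)$, the last map being the projection. For an ideal $I\subset\mathcal{O}$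 of colength $d$ with $[\tilde I]=L^d_{\mathcal{E}}([I])$, $L_{\mathcal{E},I}:\mathcal{H}^{\hat{\mathbb{A}}^2_\Lambda/\Lambda}_I\to\mathcal{H}^{\hat{\mathbb{A}}^3}_{\tilde I}$ is the induced morphism of completions. For a family of equations $\mathcal{E}$ with $E_0(0,0)=0$, $L'^{\,d}_{\mathcal{E}}$ and $L'_{\mathcal{E},I}$ are defined in the same way using $\mathcal{S}'_{\mathcal{E}}=(z-E_\lambda(x,y)=0)\subset\hat{\mathbb{A}}^3_\Lambda$, with $\hat{\mathbb{A}}^3$ completed at the origin. (The completion $\hat{\mathbb{A}}^3$ thus depends on the factor; $S_{w_i-1}$ and $S'$ are understood in the corresponding completion.) The maps $\Phi$ and $\Delta$. Let $\Lambda$ be regular and $I\subseteq\mathcal{O}$ an ideal of finite colength containing $E_0$. Tangent vectors $\mathbf{v}\in T_0\Lambda$ act as derivations on the $\lambda$-coordinates. Define $\Delta_{\mathcal{E},I}:T_0\Lambda\to\mathcal{O}/I$, $\mathbf{v}\mapsto\mathbf{v}(E_\lambda(x,y))+I$; and, for a family of $w$-contact equations, $\Phi_{\mathcal{E},I}:T_0\Lambda\to\mathcal{O}/I$, $\mathbf{v}\mapsto\mathbf{v}\left(f_\lambda(x,y)/g_\lambda(x)\right)+I$. *)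

(* Defs.v *)
From HB Require Import structures.
From mathcomp Require Import all_boot all_order all_algebra.
From mathcomp Require Import boolp classical_sets reals.
From mathcomp Require Import complex.

Set Implicit Arguments.
Unset Strict Implicit.
Unset Printing Implicit Defensive.

Import GRing.Theory.
Local Open Scope ring_scope.
Local Open Scope classical_set_scope.

(** [fps A] is A[[t]]; a record rather than [nat -> A], which already carries
    the pointwise product.  Several variables are obtained by iteration. *)

Record fps (A : Type) := Fps { fcoef :> nat -> A }.

Lemma fpsP (A : Type) (p q : fps A) : (forall n, p n = q n) <-> p = q.
Proof.
split=> [|->//]; case: p => p; case: q => q /= pq.
by congr Fps; apply: funext.
Qed.

HB.instance Definition _ (A : Type) := gen_eqMixin (fps A).
HB.instance Definition _ (A : Type) := gen_choiceMixin (fps A).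

Section FpsRing.
Variable A : comNzRingType.
Implicit Types p q r : fps A.

Definition fps_zero : fps A := Fps (fun=> 0).
Definition fps_add p q : fps A := Fps (fun n => p n + q n).
Definition fps_opp p : fps A := Fps (fun n => - p n).
Definition fpsC (a : A) : fps A := Fps (fun n => if n == 0%N then a else 0).
Definition fpsX : fps A := Fps (fun n => (n == 1%N)%:R).
Definition fps_mul p q : fps A := Fps (fun n => \sum_(i < n.+1) p i * q (n - i)%N).

Let addA : associative fps_add.
Proof. by move=> p q r; apply/fpsP => n /=; rewrite addrA. Qed.
Let addC : commutative fps_add.
Proof. by move=> p q; apply/fpsP => n /=; rewrite addrC. Qed.
Let add0 : left_id fps_zero fps_add.
Proof. by move=> p; apply/fpsP => n /=; rewrite add0r. Qed.
Let addN : left_inverse fps_zero fps_opp fps_add.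
Proof. by move=> p; apply/fpsP => n /=; rewrite addNr. Qed.

HB.instance Definition _ := GRing.isZmodule.Build (fps A) addA addC add0 addN.

Let trunc n p : {poly A} := \poly_(i < n.+1) p i.

Let coef_trunc n p i : (i <= n)%N -> (trunc n p)`_i = p i.
Proof. by move=> le_in; rewrite coef_poly ltnS le_in. Qed.

Let mul_trunc n p q i : (i <= n)%N ->
  fps_mul p q i = (trunc n p * trunc n q)`_i.
Proof.
move=> le_in; rewrite coefM /=; apply: eq_bigr => j _.
have le_ji : (j <= i)%N by rewrite -ltnS.
rewrite !coef_trunc //; first exact: leq_trans (leq_subr _ _) le_in.
exact: leq_trans le_ji le_in.
Qed.

Let mulA : associative fps_mul.
Proof.
move=> p q r; apply/fpsP => n.
rewrite !(@mul_trunc n) //.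
transitivity ((trunc n p * (trunc n q * trunc n r))`_n).
  rewrite !coefM; apply: eq_bigr => i _; congr (_ * _).
  by rewrite coef_trunc ?leq_subr // (@mul_trunc n) ?leq_subr.
rewrite mulrA !coefM; apply: eq_bigr => i _; congr (_ * _).
have le_in : (i <= n)%N by rewrite -ltnS.
by rewrite coef_trunc // (@mul_trunc n).
Qed.

Let mulC : commutative fps_mul.
Proof. by move=> p q; apply/fpsP => n; rewrite !(@mul_trunc n) // mulrC. Qed.

Let mul1 : left_id (fpsC 1) fps_mul.
Proof.
move=> p; apply/fpsP => n /=.
by rewrite big_ord_recl /= mul1r subn0 big1 ?addr0 // => i _; rewrite mul0r.
Qed.

Let mulD : left_distributive fps_mul fps_add.
Proof.
move=> p q r; apply/fpsP => n /=; rewrite -big_split /=.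
by apply: eq_bigr => i _; rewrite mulrDl.
Qed.

Let nz1 : fpsC 1 != 0.
Proof.
apply/eqP => /fpsP /(_ 0%N) /= /eqP.
by rewrite oner_eq0.
Qed.

HB.instance Definition _ :=
  GRing.Zmodule_isComNzRing.Build (fps A) mulA mulC mul1 mulD nz1.

Definition fps_unit : pred (fps A) := fun p => `[< exists q, q * p = 1 >].
Definition fps_inv p : fps A :=
  if pselect (exists q, q * p = 1) is left ex_q then projT1 (cid ex_q) else p.

Let mulV : {in fps_unit, left_inverse 1 fps_inv *%R}.
Proof.
move=> p /asboolP ex_q; rewrite /fps_inv; case: pselect => // ex_q'.
by case: cid.
Qed.
Let unitP p q : q * p = 1 -> fps_unit p.
Proof. by move=> qp1; apply/asboolP; exists q. Qed.
Let inv_out : {in [predC fps_unit], fps_inv =1 id}.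
Proof.
move=> p /= /asboolPn nex_q; rewrite /fps_inv; case: pselect => // ex_q.
Qed.

HB.instance Definition _ :=
  GRing.ComNzRing_hasMulInverse.Build (fps A) mulV unitP inv_out.

End FpsRing.

Definition fps_map (A B : Type) (f : A -> B) (p : fps A) : fps B :=
  Fps (fun n => f (p n)).

(** [ps2 A] is A[[x,y]] = A[[x]][[y]] and [ps3 A] is A[[x,y,t]]. *)

Notation ps2 A := (fps (fps A)).
Notation ps3 A := (fps (fps (fps A))).

Definition ps2C (A : comNzRingType) (a : A) : ps2 A := fpsC (fpsC a).
Definition ps3C (A : comNzRingType) (a : A) : ps3 A := fpsC (ps2C a).
Definition ps2_map (A B : Type) (f : A -> B) : ps2 A -> ps2 B :=
  fps_map (fps_map f).
Definition ps3_map (A B : Type) (f : A -> B) : ps3 A -> ps3 B :=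
  fps_map (ps2_map f).

Definition coord2_x (A : comNzRingType) : ps2 A := fpsC (@fpsX A).
Definition coord2_y (A : comNzRingType) : ps2 A := @fpsX (fps A).

(** When A[[x,y,t]] is the completion of A^3 at x = y = 0, z = c, the local
    parameter t is z - c. *)
Definition coord3_x (A : comNzRingType) : ps3 A := fpsC (coord2_x A).
Definition coord3_y (A : comNzRingType) : ps3 A := fpsC (coord2_y A).
Definition coord3_z (A : comNzRingType) (c : A) : ps3 A :=
  @fpsX (ps2 A) + ps3C c.

Section Ideals.
Variable S : comNzRingType.

Definition is_ideal (J : set S) : Prop :=
  [/\ J 0, forall a b, J a -> J b -> J (a + b) & forall a b, J b -> J (a * b)].

Definition ideal_gen (X : set S) : set S :=
  [set a | forall J, is_ideal J -> X `<=` J -> J a].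

Definition ideal_exp (m : set S) (n : nat) : set S :=
  ideal_gen [set a | exists2 u : 'I_n -> S,
                       (forall i, m (u i)) & a = \prod_(i < n) u i].

Definition prime_ideal (J : set S) : Prop :=
  [/\ is_ideal J, ~ J 1 & forall a b, J (a * b) -> J a \/ J b].

Definition noetherian : Prop :=
  forall J : set S, is_ideal J ->
    exists s : seq S, J = ideal_gen [set a | a \in s].

Definition artinian : Prop :=
  forall J : nat -> set S, (forall n, is_ideal (J n)) ->
    (forall n, J n.+1 `<=` J n) ->
    exists n, forall m, (n <= m)%N -> J m = J n.

Definition prime_chain (n : nat) (P : nat -> set S) : Prop :=
  (forall i, (i <= n)%N -> prime_ideal (P i)) /\
  (forall i, (i < n)%N -> P i `<` P i.+1).

Definition has_krull_dim (n : nat) : Prop :=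
  (exists P, prime_chain n P) /\ (forall m P, prime_chain m P -> (m <= n)%N).

End Ideals.

(** Flatness of S/J over A, for S an A-algebra through [iota].  Bilinear
    maps N x S/J -> P are bilinear maps on N x S vanishing on N x J, and an
    element of N (x)_A S/J is zero iff every bilinear map kills it. *)

Section Flat.
Variables (A S : comNzRingType) (iota : A -> S) (J : set S).

Definition bilinear_mod (N P : lmodType A) (b : N -> S -> P) : Prop :=
  [/\ forall m n s, b (m + n) s = b m s + b n s,
      forall n s t, b n (s + t) = b n s + b n t,
      forall a n s, b (a *: n) s = a *: b n s,
      forall a n s, b n (iota a * s) = a *: b n s &
      forall n s, J s -> b n s = 0].

(** The pairs (n, s) listed in [u] satisfy: \sum n (x) s = 0 in N (x)_A S/J. *)
Definition tensor_eq0 (N : lmodType A) (u : seq (N * S)) : Prop :=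
  forall (P : lmodType A) (b : N -> S -> P), bilinear_mod b ->
    \sum_(p <- u) b p.1 p.2 = 0.

Definition flat_quotient : Prop :=
  forall (N N' : lmodType A) (i : {linear N -> N'}), injective i ->
    forall u : seq (N * S),
      tensor_eq0 [seq (i p.1, p.2) | p <- u] -> tensor_eq0 u.

End Flat.

(** A local K-algebra with residue field K, presented by its (unique)
    augmentation. *)

Record localAlg (K : fieldType) := LocalAlg {
  lalg :> comAlgType K;
  aug : {lrmorphism lalg -> K^o};
  aug_unit : forall a : lalg, aug a != 0 -> exists b, a * b = 1
}.

Section LocalAlg.
Variables (K : fieldType) (R : localAlg K).

Definition residue : R -> K := aug R.
Definition max_ideal : set R := [set a | residue a = 0].

(** The map R -> lim R/m^n is bijective. *)
Definition adically_complete : Prop :=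
  (forall a : R, (forall n, ideal_exp max_ideal n a) -> a = 0) /\
  (forall u : nat -> R,
     (forall n, ideal_exp max_ideal n (u n.+1 - u n)) ->
     exists a, forall n, ideal_exp max_ideal n (a - u n)).

Definition cotangent_dim (n : nat) : Prop :=
  exists2 e : 'I_n -> R, (forall i, max_ideal (e i)) &
    forall a, max_ideal a -> exists! c : {ffun 'I_n -> K},
      ideal_exp max_ideal 2 (a - \sum_(i < n) c i *: e i).

Definition regular_local : Prop :=
  exists2 n, has_krull_dim R n & cotangent_dim n.

(** Elements of T_0 Spf R, as point derivations. *)
Definition tangent_vector (v : {linear R -> K^o}) : Prop :=
  forall a b : R, v (a * b) = residue a * v b + residue b * v a.

End LocalAlg.

Record artAlg (K : fieldType) := ArtAlg {
  art_alg :> localAlg K;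
  art_artinian : artinian art_alg
}.

(** A formal spectrum of a complete local K-algebra with residue field K is
    identified with the functor it pro-represents on [artAlg K].  The functors
    below are given by an ambient type with base change, [ambient], together
    with the set of valid A-points, a [formal_sub].  Algebra morphisms between
    local artinian K-algebras with residue field K are automatically local. *)

Record ambient (K : fieldType) := Ambient {
  pt : artAlg K -> Type;
  base_change : forall A B : artAlg K, {lrmorphism A -> B} -> pt A -> pt B
}.

Definition formal_sub (K : fieldType) (X : ambient K) :=
  forall A : artAlg K, set (pt X A).

Section Morphisms.
Variables (K : fieldType) (X Y : ambient K).
Variables (F : formal_sub X) (G : formal_sub Y).
Variable L : forall A : artAlg K, pt X A -> pt Y A.
Arguments F : clear implicits.
Arguments G : clear implicits.
Arguments L : clear implicits.

Definition is_morphism : Prop :=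
  (forall A p, F A p -> G A (L A p)) /\
  (forall (A B : artAlg K) (psi : {lrmorphism A -> B}) p, F A p ->
     L B (base_change psi p) = base_change psi (L A p)).

Definition formally_smooth : Prop :=
  forall (A B : artAlg K) (psi : {lrmorphism B -> A}),
    (forall a, exists b, psi b = a) ->
    forall (p : pt X A) (q : pt Y B),
    F A p -> G B q -> base_change psi q = L A p ->
    exists2 p' : pt X B, F B p' & base_change psi p' = p /\ L B p' = q.

(** There are n functions on F which together with L identify F with the
    formal affine space of dimension n over G: when F and G are pro-represented
    by S and T, this says S = T[[t_1, ..., t_n]]. *)
Definition has_relative_coordinates (n : nat) : Prop :=
  exists theta : forall A : artAlg K, pt X A -> 'I_n -> A,
  [/\ forall A p, F A p -> forall i, max_ideal (theta A p i),
      forall (A B : artAlg K) (psi : {lrmorphism A -> B}) p, F A p ->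
        forall i, theta B (base_change psi p) i = psi (theta A p i) &
      forall A (q : pt Y A) (t : 'I_n -> A),
        G A q -> (forall i, max_ideal (t i)) ->
        exists! p : pt X A, [/\ F A p, L A p = q & theta A p = t]].

Definition smooth_of_relative_dim (n : nat) : Prop :=
  [/\ is_morphism, formally_smooth & has_relative_coordinates n].

End Morphisms.

Section Hilbert.
Variable K : fieldType.

Definition colength (I : set (ps2 K)) (d : nat) : Prop :=
  exists e : 'I_d -> ps2 K, forall f, exists! c : {ffun 'I_d -> K},
    I (f - \sum_(i < d) ps2C (c i) * e i).

(** A-points of the formal Hilbert schemes of the formal affine plane
    ([hilb2]) and of the formal affine 3-space ([hilb3]) at the ideal I.  Those
    of a closed formal subscheme are the J containing its equation. *)
Definition hilb2 (A : artAlg K) (I : set (ps2 K)) : set (set (ps2 A)) :=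
  [set J | [/\ is_ideal J, flat_quotient (@ps2C A) J &
               ps2_map (@residue K A) @` J = I]].

Definition hilb3 (A : artAlg K) (I : set (ps3 K)) : set (set (ps3 A)) :=
  [set J | [/\ is_ideal J, flat_quotient (@ps3C A) J &
               ps3_map (@residue K A) @` J = I]].

(** The ideal, in A[[x,y,z-c]], of the subscheme of the graph z = h(x,y)
    lying over the subscheme of the plane with ideal J.  It is meaningful when
    h(0,0) - c is nilpotent. *)
Definition graph_ideal (A : comNzRingType) (c : A) (h : ps2 A)
    (J : set (ps2 A)) : set (ps3 A) :=
  ideal_gen ((@fpsC (ps2 A)) @` J `|` [set coord3_z c - fpsC h]).

(** [eqS c n] is yz + x^(n+1), [eqS'] is z. *)
Definition eqS (A : comNzRingType) (c : A) (n : nat) : ps3 A :=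
  coord3_y A * coord3_z c + coord3_x A ^+ n.+1.
Definition eqS' (A : comNzRingType) : ps3 A := coord3_z (0 : A).

End Hilbert.

Section Families.
Variables (K : fieldType) (R : localAlg K).

Definition closed_fiber (E : ps2 R) : ps2 K := ps2_map (@residue K R) E.

(** The restriction to D = (y = 0) is the coefficient of y^0. *)
Definition contact_equation (w : nat) (E : ps2 R) : Prop :=
  exists2 u : fps R, u \is a GRing.unit & E 0%N = @fpsX R ^+ w * u.

(** E = y f + x^w g, see [contact_decomposition]; the slope is f / g. *)
Definition contact_f (E : ps2 R) : ps2 R := Fps (fun n => E n.+1).
Definition contact_g (w : nat) (E : ps2 R) : fps R :=
  Fps (fun n => E 0%N (n + w)%N).
Definition contact_slope (w : nat) (E : ps2 R) : ps2 R :=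
  fpsC (contact_g w E)^-1 * contact_f E.

(** g_0(0)^-1 f_0(0,0) *)
Definition contact_center (w : nat) (E : ps2 R) : K :=
  (residue (contact_g w E 0%N))^-1 * residue (contact_f E 0%N 0%N).

Definition graph_contact (w : nat) (E : ps2 R) (I : set (ps2 K)) :
    set (ps3 K) :=
  graph_ideal (contact_center w E) (closed_fiber (contact_slope w E)) I.
Definition graph_eq (E : ps2 R) (I : set (ps2 K)) : set (ps3 K) :=
  graph_ideal 0 (closed_fiber E) I.

End Families.

Section FamiliesTheory.
Variables (K : fieldType) (R : localAlg K).

Lemma coef_fpsXM (A : comNzRingType) (p : fps A) n :
  (@fpsX A * p) n = if n is m.+1 then p m else 0.
Proof.
rewrite /GRing.mul /=; case: n => [|n].
  by rewrite big_ord_recl big_ord0 /= mul0r addr0.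
rewrite big_ord_recl /= mul0r add0r big_ord_recl /= mul1r big1 ?addr0.
  by rewrite /bump /= subSS subn0.
by move=> i _; rewrite /bump /= mul0r.
Qed.

Lemma coef_fpsXnM (A : comNzRingType) (p : fps A) w n :
  (@fpsX A ^+ w * p) (n + w)%N = p n.
Proof.
elim: w n => [|w IHw] n; first by rewrite expr0 mul1r addn0.
by rewrite exprS -mulrA coef_fpsXM addnS IHw.
Qed.

Lemma contact_decomposition (w : nat) (E : ps2 R) : contact_equation w E ->
  E = coord2_y R * contact_f E + coord2_x R ^+ w * fpsC (contact_g w E)
  /\ contact_g w E \is a GRing.unit.
Proof.
case=> u Uu Eu.
have -> : contact_g w E = u.
  by apply/fpsP => n; rewrite /contact_g /= Eu coef_fpsXnM.
split=> //.
have fpsCM (A : comNzRingType) (a b : A) : fpsC (a * b) = fpsC a * fpsC b.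
  apply/fpsP => n; rewrite {2}/GRing.mul /= big_ord_recl /= big1.
    by rewrite subn0 addr0; case: eqP => //; rewrite mulr0.
  by move=> i _; rewrite mul0r.
have -> : coord2_x R ^+ w = fpsC (@fpsX R ^+ w).
  elim: w {Eu} => [|w IHw]; first by rewrite !expr0.
  by rewrite !exprS IHw /coord2_x fpsCM.
rewrite -fpsCM -Eu; apply/fpsP => n.
have -> (p q : ps2 R) : (p + q) n = p n + q n by [].
rewrite coef_fpsXM.
by case: n => [|n] /=; rewrite ?add0r ?addr0.
Qed.

End FamiliesTheory.

Section Products.
Variables (K : fieldType) (R : localAlg K) (k l : nat).

(** Points of a fiber product over Spf R of relative Hilbert schemes: an
    R-algebra structure on A and ideals of A[[x,y]]. *)
Record source_pt (A : artAlg K) := SourcePt {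
  src_base : {lrmorphism R -> A};
  src : 'I_k -> set (ps2 A);
  src' : 'I_l -> set (ps2 A)
}.

Record target_pt (A : artAlg K) := TargetPt {
  tgt : 'I_k -> set (ps3 A);
  tgt' : 'I_l -> set (ps3 A)
}.

Definition source : ambient K := @Ambient K source_pt
  (fun A B psi p => SourcePt
     (GRing.LRMorphism.clone _ _ _ _ (psi \o src_base p) _)
     (fun i => ideal_gen (ps2_map psi @` src p i))
     (fun j => ideal_gen (ps2_map psi @` src' p j))).

Definition target : ambient K := @Ambient K target_pt
  (fun A B psi p => TargetPt
     (fun i => ideal_gen (ps3_map psi @` tgt p i))
     (fun j => ideal_gen (ps3_map psi @` tgt' p j))).

Variables (w : 'I_k -> nat) (E : 'I_k -> ps2 R) (E' : 'I_l -> ps2 R).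
Variables (I : 'I_k -> set (ps2 K)) (I' : 'I_l -> set (ps2 K)).

Definition hilb_planes : formal_sub source := fun A =>
  [set p | (forall i, hilb2 (I i) (src p i)) /\
           (forall j, hilb2 (I' j) (src' p j))].

Definition hilb_curves : formal_sub source := fun A =>
  [set p | (forall i, hilb2 (I i) (src p i) /\
                      src p i (ps2_map (src_base p) (E i))) /\
           (forall j, hilb2 (I' j) (src' p j) /\
                      src' p j (ps2_map (src_base p) (E' j)))].

Definition hilb_spaces : formal_sub target := fun A =>
  [set q | (forall i, hilb3 (graph_contact (w i) (E i) (I i)) (tgt q i)) /\
           (forall j, hilb3 (graph_eq (E' j) (I' j)) (tgt' q j))].

Definition hilb_surfaces : formal_sub target := fun A =>
  [set q | (forall i, hilb3 (graph_contact (w i) (E i) (I i)) (tgt q i) /\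
              tgt q i (eqS (contact_center (w i) (E i))%:A (w i).-1)) /\
           (forall j, hilb3 (graph_eq (E' j) (I' j)) (tgt' q j) /\
              tgt' q j (eqS' A))].

Definition morphL (A : artAlg K) (p : source_pt A) : target_pt A :=
  TargetPt
    (fun i => graph_ideal (contact_center (w i) (E i))%:A
       (ps2_map (src_base p) (contact_slope (w i) (E i))) (src p i))
    (fun j => graph_ideal 0 (ps2_map (src_base p) (E' j)) (src' p j)).

(** Surjectivity of (Phi, Delta) from T_0 onto the product of the K[[x,y]]/I;
    derivations act coefficientwise. *)
Definition PhiDelta_surjective : Prop :=
  forall (a : 'I_k -> ps2 K) (b : 'I_l -> ps2 K),
  exists2 v : {linear R -> K^o}, tangent_vector v &
    (forall i, I i (ps2_map (v : R -> K) (contact_slope (w i) (E i)) - a i)) /\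
    (forall j, I' j (ps2_map (v : R -> K) (E' j) - b j)).

End Products.

Arguments source {K} R k l.
Arguments target K k l : clear implicits.
Arguments hilb_planes {K} R {k l} I I' A.
Arguments hilb_curves {K R k l} E E' I I' A.
Arguments hilb_spaces {K R k l} w E E' I I' A.
Arguments hilb_surfaces {K R k l} w E E' I I' A.
Arguments morphL {K R k l} w E E' A p.

(* Main.v *)
Require Import Defs.
From HB Require Import structures.
From mathcomp Require Import all_boot all_order all_algebra.
From mathcomp Require Import boolp classical_sets reals.
From mathcomp Require Import complex.
From mathcomp Require Import ring.

Set Implicit Arguments.
Unset Strict Implicit.
Unset Printing Implicit Defensive.

Import GRing.Theory.
Local Open Scope ring_scope.
Local Open Scope classical_set_scope.
Local Open Scope complex_scope.

(** A point of the Hilbert scheme of 3-space at the graph of h_0 over I is the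
    graph of some v over a point J of the Hilbert scheme of the plane at I, with
    v determined modulo J.  In these terms L sends (lambda, J) to
    (J, h_lambda mod J), h being f/g or E'.  Since yz + x^w restricts to E/g on
    the graph of f/g, and z to E' on that of E', this gives (1).

    For (2), a flat quotient A[[x,y]]/J is free over A, so (h_lambda mod J) is a
    tuple of sum d_i + sum d'_j elements of A, and the hypothesis says that its
    derivative in lambda is onto.  Morphisms from a regular complete R to A
    correspond to n-tuples in the maximal ideal of A, because
    K[[e_1, ..., e_n]] -> R is bijective: a relation would allow one to cut R
    down to a finite length with n - 1 parameters.  Completing the derivative to
    an invertible matrix by r further functions of lambda, Newton's iteration
    over the artinian ring A shows that (J, h_lambda mod J) and these r functions
    determine (lambda, J) freely. *)

(** * Ideals and local algebras *)

(** The ideal J passes unchanged from source to target, so nothing about the geometry of the Hilbert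
    schemes is needed: over a fixed J only the dependence on lambda has to be inverted. To turn this
    into equations in A, one basis of K[[x,y]]/I, lifted with constant coefficients, serves for
    every A and every J. Its coordinates are A-linear, reduce to the coordinates over K, and send a
    series with coefficients in an ideal b of A into b.

    Flatness is given only as a test on injections of modules; the single injection of the socle
    into A already excludes relations between the lifted basis elements.

    The Jacobian matters only modulo m, so one constant matrix over K serves in all Newton steps,
    and each step gains a power of m.

    The bound on the dimension has to be read off chains of primes: if P_0 + (x_0, ..., x_(r-1)) has
    finite colength, every strict inclusion in a chain from P_0 costs one parameter, because
    Cayley-Hamilton yields a relation between the parameters modulo the larger prime. *)

Section IdealTheory.
Variable S : comNzRingType.
Implicit Types (J : set S) (a b : S).

Lemma ideal0 J : is_ideal J -> J 0. Proof. by case. Qed.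

Lemma idealD J a b : is_ideal J -> J a -> J b -> J (a + b).
Proof. by case=> _ + _; apply. Qed.

Lemma idealMl J a b : is_ideal J -> J b -> J (a * b).
Proof. by case=> _ _; apply. Qed.

Lemma idealMr J a b : is_ideal J -> J a -> J (a * b).
Proof. by rewrite mulrC; apply: idealMl. Qed.

Lemma idealN J a : is_ideal J -> J a -> J (- a).
Proof. by rewrite -mulN1r; apply: idealMl. Qed.

Lemma idealB J a b : is_ideal J -> J a -> J b -> J (a - b).
Proof. by move=> Jid Ja Jb; apply: idealD => //; apply: idealN. Qed.

Lemma idealBC J a b : is_ideal J -> J (a - b) -> J (b - a).
Proof. by rewrite -(opprB a); apply: idealN. Qed.

Lemma idealBT J b a c : is_ideal J -> J (a - b) -> J (b - c) -> J (a - c).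
Proof. by move=> Jid Jab Jbc; rewrite -(subrKA b); apply: idealD. Qed.

Lemma idealDr J a b : is_ideal J -> J b -> J (a + b) <-> J a.
Proof.
move=> Jid Jb; split=> Ja; last exact: idealD.
by rewrite -(addrK b a); apply: idealB.
Qed.

Lemma ideal_cong J a b : is_ideal J -> J (a - b) -> J a <-> J b.
Proof. by move=> Jid /(idealDr b Jid); rewrite addrCA subrr addr0 => ->. Qed.

Lemma ideal_sum J (T : Type) (r : seq T) (P : pred T) (F : T -> S) :
  is_ideal J -> (forall i, P i -> J (F i)) -> J (\sum_(i <- r | P i) F i).
Proof.
move=> Jid JF; elim/big_rec: _ => [|i x Pi Jx]; first exact: ideal0.
by apply: idealD => //; apply: JF.
Qed.

Lemma ideal_exprS J a m n : is_ideal J -> (m <= n)%N -> J (a ^+ m) -> J (a ^+ n).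
Proof. by move=> Jid /subnK <-; rewrite exprD; apply: idealMl. Qed.

Lemma ideal_congX J a b n : is_ideal J -> J (a - b) -> J (a ^+ n - b ^+ n).
Proof. by move=> Jid Jab; rewrite subrXX; apply: idealMr. Qed.

Lemma ideal_full J a : is_ideal J -> J 1 -> J a.
Proof. by move=> Jid J1; rewrite -[a]mulr1; exact: idealMl. Qed.

Lemma ideal_gen_ideal (X : set S) : is_ideal (ideal_gen X).
Proof.
split=> [J []//|a b Xa Xb J Jid XJ|a b Xb J Jid XJ].
  by apply: idealD => //; [apply: Xa|apply: Xb].
by apply: idealMl => //; apply: Xb.
Qed.

Lemma sub_ideal_gen (X : set S) : X `<=` ideal_gen X.
Proof. by move=> a Xa J _; apply. Qed.

Lemma ideal_gen_min (X J : set S) :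
  is_ideal J -> X `<=` J -> ideal_gen X `<=` J.
Proof. by move=> Jid XJ a; apply. Qed.

Lemma ideal_gen_id (J : set S) : is_ideal J -> ideal_gen J = J.
Proof.
move=> Jid; apply/seteqP; split; first exact: ideal_gen_min.
exact: sub_ideal_gen.
Qed.

Lemma set10_ideal : is_ideal [set 0 : S].
Proof.
by split=> //= a b => [->->|->]; rewrite ?addr0 ?mulr0.
Qed.

Lemma span_ideal n (e : 'I_n -> S) :
  is_ideal [set a | exists b : 'I_n -> S, a = \sum_i b i * e i].
Proof.
split=> [|_ _ [b ->] [c ->]|a _ [b ->]].
- by exists (fun=> 0); rewrite big1 // => i _; rewrite mul0r.
- by exists (fun i => b i + c i); rewrite -big_split; apply: eq_bigr => i _; rewrite mulrDl.
- by exists (fun i => a * b i); rewrite mulr_sumr; apply: eq_bigr => i _; rewrite mulrA.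
Qed.

Lemma ideal_gen_seqP (s : seq S) a :
  ideal_gen [set a | a \in s] a -> exists c : 'I_(size s) -> S, a = \sum_i c i * s`_i.
Proof.
apply: (ideal_gen_min (span_ideal (fun i : 'I_(size s) => s`_i))).
move=> _ /seq_tnthP[i ->]; exists (fun j => (j == i)%:R).
rewrite (bigD1 i) //= eqxx mul1r big1 ?addr0 => [|j /negPf->]; last by rewrite mul0r.
by rewrite (tnth_nth 0).
Qed.

(** The colon ideal (J : X). Applying [ideal_gen_min] to it reduces a claim about products to a
    claim about generators. *)
Lemma ideal_transporter J (X : set S) : is_ideal J ->
  is_ideal [set a | forall b, X b -> J (a * b)].
Proof.
move=> Jid; split=> [b _|a c Ja Jc b Xb|a c Jc b Xb].
- by rewrite mul0r; apply: ideal0.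
- by rewrite mulrDl; apply: idealD => //; [apply: Ja|apply: Jc].
- by rewrite -mulrA; apply: idealMl => //; apply: Jc.
Qed.

Lemma ideal_exp_ideal (m : set S) n : is_ideal (ideal_exp m n).
Proof. exact: ideal_gen_ideal. Qed.

Lemma ideal_exp0 (m : set S) a : ideal_exp m 0 a.
Proof.
apply: (@ideal_full (ideal_exp m 0)); first exact: ideal_exp_ideal.
by apply: sub_ideal_gen => /=; exists (fun=> 0) => [[]//|]; rewrite big_ord0.
Qed.

Lemma ideal_exp_mulS (m : set S) n a b :
  m a -> ideal_exp m n b -> ideal_exp m n.+1 (a * b).
Proof.
move=> ma; rewrite mulrC => mb.
have Jid := @ideal_transporter _ [set a] (ideal_exp_ideal m n.+1).
suff H : ideal_exp m n `<=` [set c | forall d, [set a] d -> ideal_exp m n.+1 (c * d)].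
  exact: (H b).
apply: ideal_gen_min => // _ [u mu ->] _ ->.
apply: sub_ideal_gen => /=.
exists (fun i => oapp u a (unlift ord_max i)).
  by move=> i; case: unliftP => [j _|_] /=.
rewrite big_ord_recr /= unlift_none /=; congr (_ * _).
apply: eq_bigr => i _.
have -> : widen_ord (leqnSn n) i = lift ord_max i.
  by apply: val_inj; rewrite /= /bump leqNgt ltn_ord.
by rewrite liftK.
Qed.

Lemma ideal_exp_ind (m : set S) n (J : set S) : is_ideal J ->
  (forall a b, m a -> ideal_exp m n b -> J (a * b)) ->
  ideal_exp m n.+1 `<=` J.
Proof.
move=> Jid Jab; apply: ideal_gen_min => // _ [u mu ->].
rewrite big_ord_recl; apply: Jab => //.
by apply: sub_ideal_gen; exists (fun i => u (lift ord0 i)).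
Qed.

Lemma ideal_expS (m : set S) n : ideal_exp m n.+1 `<=` ideal_exp m n.
Proof.
apply: ideal_exp_ind => [|a b _]; first exact: ideal_exp_ideal.
by apply: idealMl; apply: ideal_exp_ideal.
Qed.

Lemma ideal_exp_le (m : set S) i j : (i <= j)%N -> ideal_exp m j `<=` ideal_exp m i.
Proof.
elim: j => [|j IHj]; first by rewrite leqn0 => /eqP->.
rewrite leq_eqVlt => /predU1P[->//|]; rewrite ltnS => /IHj ji.
exact: subset_trans (@ideal_expS m j) ji.
Qed.

Lemma ideal_exp_expr (m : set S) a n : m a -> ideal_exp m n (a ^+ n).
Proof.
move=> ma; elim: n => [|n IHn]; first exact: ideal_exp0.
by rewrite exprS; apply: ideal_exp_mulS.
Qed.

Lemma ideal_exp_add_min (m : set S) i j (J : set S) : is_ideal J ->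
  (forall a b, ideal_exp m i a -> ideal_exp m j b -> J (a * b)) ->
  ideal_exp m (i + j) `<=` J.
Proof.
elim: i J => [|i IHi] J Jid Jab.
  by move=> b mb; rewrite -[b]mul1r; apply: Jab => //; apply: ideal_exp0.
rewrite addSn; apply: ideal_exp_ind => // a b ma mb.
have Jid' := @ideal_transporter J [set a] Jid.
suff H : ideal_exp m (i + j) `<=` [set b | forall c, [set a] c -> J (b * c)].
  by rewrite mulrC; apply: (H b).
apply: IHi => // c d mc md _ ->; rewrite mulrC mulrA; apply: Jab => //.
exact: ideal_exp_mulS.
Qed.

Lemma ideal_exp1 (m : set S) : is_ideal m -> ideal_exp m 1 = m.
Proof.
move=> mid; apply/seteqP; split.
  by apply: ideal_exp_ind => // a b ma _; apply: idealMr.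
by move=> a ma; rewrite -[a]expr1; apply: ideal_exp_expr.
Qed.

End IdealTheory.

Lemma ideal_preim (S T : comNzRingType) (f : {rmorphism S -> T}) (J : set T) :
  is_ideal J -> is_ideal (f @^-1` J).
Proof.
move=> Jid; split=> /= [|a b|a b]; first by rewrite rmorph0; apply: ideal0.
  by rewrite rmorphD; apply: idealD.
by rewrite rmorphM; apply: idealMl.
Qed.

Lemma ideal_image (S T : comNzRingType) (f : {rmorphism S -> T}) (J : set S) :
  (forall t, exists s, f s = t) -> is_ideal J -> is_ideal (f @` J).
Proof.
move=> f_surj Jid; split.
- by exists 0; [apply: ideal0|rewrite rmorph0].
- by move=> _ _ [a Ja <-] [b Jb <-]; exists (a + b); [apply: idealD|rewrite rmorphD].
- move=> t _ [b Jb <-]; have [a <-] := f_surj t.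
  by exists (a * b); [apply: idealMl|rewrite rmorphM].
Qed.

Section LocalAlgTheory.
Variables (K : fieldType) (R : localAlg K).

HB.instance Definition _ := GRing.LRMorphism.copy (@residue K R) (aug R).

Lemma residueC (c : K) : residue (c%:A : R) = c.
Proof. by rewrite linearZ /= rmorph1; apply: mulr1. Qed.

Lemma residue_surj (c : K) : exists a : R, residue a = c.
Proof. by exists c%:A; rewrite residueC. Qed.

Lemma max_ideal_ideal : is_ideal (@max_ideal K R).
Proof. exact: (@ideal_preim _ _ (@residue K R) _ (set10_ideal K)). Qed.

Lemma max_ideal_residueB (a : R) : max_ideal (a - (residue a)%:A).
Proof. by rewrite /max_ideal /= rmorphB /= residueC subrr. Qed.

Lemma residue_unit (a : R) : residue a != 0 -> exists b, a * b = 1.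
Proof. exact: aug_unit. Qed.

Lemma ideal_unitl (J : set R) (c x : R) : is_ideal J -> residue c != 0 ->
  J (c * x) -> J x.
Proof.
move=> Jid /residue_unit[b cb] Jcx.
by rewrite -[x]mul1r -cb [c * b]mulrC -mulrA; apply: idealMl.
Qed.

End LocalAlgTheory.

Lemma residue_lrmorph (K : fieldType) (R A : localAlg K)
  (f : {lrmorphism R -> A}) (a : R) : residue (f a) = residue a.
Proof.
suff m a' : max_ideal a' -> residue (f a') = 0.
  have := m _ (max_ideal_residueB a); rewrite !rmorphB /= rmorph_alg residueC.
  by move/eqP; rewrite subr_eq0 => /eqP.
move=> ma; apply: contrapT => /eqP fa0; set c := residue (f a').
have [b /(congr1 (fun x => residue (f x)))] : exists b, (a' - c%:A) * b = 1.
  by apply: residue_unit; rewrite rmorphB /= residueC ma sub0r oppr_eq0.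
rewrite !rmorphM !rmorphB /= rmorph_alg residueC subrr mul0r !rmorph1.
by move/esym/eqP; rewrite oner_eq0.
Qed.

Section Artinian.
Variables (K : fieldType) (A : artAlg K).

(** A stable power J of m satisfies J * J = J. If J were nonzero, one could multiply by elements of
    J forever without ever killing J; the descending chain of principal ideals obtained this way has
    to stop, against Nakayama. *)
Lemma artinian_nilpotent : exists Q, ideal_exp (@max_ideal K A) Q `<=` [set 0].
Proof.
set m := @max_ideal K A.
have [Q stabQ] := @art_artinian _ A (ideal_exp m) (@ideal_exp_ideal _ m) (@ideal_expS _ m).
(* The exponent is made positive so that J lies in m. *)
exists Q.+1; apply: contrapT => nJ0; set J := ideal_exp m Q.+1 in nJ0.
have JE : ideal_exp m (Q.+1 + Q.+1) = J.
  by rewrite /J !stabQ // (leq_trans (leqnSn Q)) ?leq_addr.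
have Jm : J `<=` m.
  by rewrite -[X in _ `<=` X](ideal_exp1 (@max_ideal_ideal _ A)); apply: ideal_exp_le.
pose nz (x : A) := exists2 y, J y & x * y != 0; pose T := {x | nz x}.
have step (x : T) : exists x' : T, exists2 y, J y & sval x' = y * sval x.
  case: x => x [y Jy /eqP xy0] /=; apply: contrapT => nx'; apply: xy0; move: y Jy.
  suff H : J `<=` [set a | forall b, [set x] b -> [set (0 : A)] (a * b)].
    by move=> y /H /(_ x erefl); rewrite mulrC.
  rewrite -JE; apply: ideal_exp_add_min.
    by apply: ideal_transporter; apply: set10_ideal.
  move=> a b Ja Jb _ -> /=; apply: contrapT => /eqP abx.
  have x'P : nz (a * x) by exists b => //; rewrite mulrAC.
  by apply: nx'; exists (exist nz _ x'P), a.
have [next nextP] := choice step.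
have [y0 Jy0 y00] : exists2 y, J y & y != 0.
  apply: contrapT => nJ; apply: nJ0 => y Jy; apply: contrapT => /eqP y0.
  by apply: nJ; exists y.
have T0 : nz 1 by exists y0 => //; rewrite mul1r.
pose x n := sval (iter n next (exist nz _ T0)).
have [n xn] : exists n, forall i, (n <= i)%N ->
    [set a * x i | a in setT] = [set a * x n | a in setT].
  apply: (@art_artinian _ A (fun n => [set a * x n | a in setT])) => n.
    split; first by exists 0; rewrite ?mul0r.
      by move=> _ _ [a _ <-] [b _ <-]; exists (a + b); rewrite ?mulrDl.
    by move=> a _ [b _ <-]; exists (a * b); rewrite ?mulrA.
  move=> _ [a _ <-]; have [y _ nextE] := nextP (iter n next (exist nz _ T0)).
  by exists (a * y) => //; rewrite /x /= nextE mulrA.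
have : [set a * x n | a in setT] (x n) by exists 1; rewrite ?mul1r.
rewrite -(xn n.+1) // => -[a _]; have [y Jy] := nextP (iter n next (exist nz _ T0)).
rewrite -/(x n) /x /= -/(x n) => ->; rewrite mulrA => axn.
(* Stability of the chain gives [x n = a * y * x n] with [y] in J, and [1 - a * y] is a unit. *)
have xn0 : x n = 0.
  apply: (@ideal_unitl _ _ [set 0] (1 - a * y) _ (set10_ideal A)).
    have : m (a * y) by apply: idealMl; [apply: max_ideal_ideal|apply: Jm].
    by rewrite rmorphB rmorph1 /= => ->; rewrite subr0 oner_neq0.
  by rewrite /= mulrBl mul1r axn subrr.
have [z _] := svalP (iter n next (exist nz _ T0)).
by rewrite -/(x n) xn0 mul0r eqxx.
Qed.

Lemma artinian_complete : adically_complete A.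
Proof.
have [Q mQ] := artinian_nilpotent; split=> [a /(_ Q)/mQ//|u u_cauchy].
exists (u Q) => n; have [nQ|/ltnW Qn] := leqP n Q.
  elim: Q nQ {mQ} => [|Q IHQ].
    by rewrite leqn0 => /eqP->; rewrite subrr; apply: ideal0; apply: ideal_exp_ideal.
  rewrite leq_eqVlt => /predU1P[->|nQ].
    by rewrite subrr; apply: ideal0; apply: ideal_exp_ideal.
  apply: (idealBT (ideal_exp_ideal _ _) _ (IHQ nQ)).
  by apply: (@ideal_exp_le _ _ n Q) => //; apply: u_cauchy.
suff -> : u n = u Q by rewrite subrr; apply: ideal0; apply: ideal_exp_ideal.
elim: n Qn => [|n IHn]; first by rewrite leqn0 => /eqP->.
rewrite leq_eqVlt => /predU1P[->//|Qn]; rewrite -IHn //.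
apply/eqP; rewrite -subr_eq0; apply/eqP; apply: mQ.
by apply: (@ideal_exp_le _ _ Q n) => //; apply: u_cauchy.
Qed.

End Artinian.

(** * Power series in several variables *)

Section FpsTheory.
Variable A : comNzRingType.
Implicit Types p q : fps A.

Lemma coef_fpsD p q n : (p + q) n = p n + q n. Proof. by []. Qed.

Lemma coef_fpsB p q n : (p - q) n = p n - q n. Proof. by []. Qed.

Lemma coef_fps_sum (I : Type) (r : seq I) (F : I -> fps A) n :
  (\sum_(i <- r) F i) n = \sum_(i <- r) F i n.
Proof. by elim/big_rec2: _ => // i a b _ <-. Qed.

Lemma coef_fpsM p q n : (p * q) n = \sum_(i < n.+1) p i * q (n - i)%N.
Proof. by []. Qed.

Lemma coef_fpsCM (a : A) p n : (fpsC a * p) n = a * p n.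
Proof.
rewrite coef_fpsM big_ord_recl /= subn0 big1 ?addr0 // => i _.
by rewrite mul0r.
Qed.

Lemma fpsC_zmod_morphism : zmod_morphism (@fpsC A).
Proof.
by move=> a b; apply/fpsP => -[|n] /=; rewrite ?subr0.
Qed.

Lemma fpsC_monoid_morphism : monoid_morphism (@fpsC A).
Proof.
split=> // a b; apply/fpsP => -[|n]; rewrite coef_fpsCM //=.
by rewrite mulr0.
Qed.

HB.instance Definition _ :=
  GRing.isZmodMorphism.Build A (fps A) (@fpsC A) fpsC_zmod_morphism.
HB.instance Definition _ :=
  GRing.isMonoidMorphism.Build A (fps A) (@fpsC A) fpsC_monoid_morphism.

Definition fps_shift p : fps A := Fps (fun n => p n.+1).

Lemma fps_decomp p : p = fpsC (p 0%N) + @fpsX A * fps_shift p.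
Proof.
apply/fpsP => n; rewrite coef_fpsD coef_fpsXM.
by case: n => [|n]; rewrite /= ?addr0 ?add0r.
Qed.

Lemma fps_truncE p n : p = \sum_(i < n) fpsC (p i) * @fpsX A ^+ i
   + @fpsX A ^+ n * iter n fps_shift p.
Proof.
have iterE m i : iter m fps_shift p i = p (i + m)%N.
  by elim: m i => [|m IHm] i /=; rewrite ?addn0 // IHm addSnnS.
elim: n => [|n IHn]; first by rewrite big_ord0 add0r mul1r.
rewrite big_ord_recr /= {1}IHn -addrA; congr (_ + _).
by rewrite {1}[iter n _ _]fps_decomp iterE add0n mulrDr mulrC exprSr mulrA.
Qed.

Lemma coef_fpsXn_lt p n i : (i < n)%N -> (@fpsX A ^+ n * p) i = 0.
Proof.
elim: n i => // n IHn [|i] lt_in; rewrite exprS -mulrA coef_fpsXM //.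
exact: IHn.
Qed.

(** Geometric series: p b = 1 - s with s divisible by the variable, and the n-th coefficient of the
    partial sums of the s^i no longer changes after the n-th sum. *)
Lemma fps_inverse p (b : A) : p 0%N * b = 1 -> exists q, p * q = 1.
Proof.
move=> p0b; set h := - (fpsC b * fps_shift p); set s := @fpsX A * h.
have pbE : p * fpsC b = 1 - s.
  rewrite {1}[p]fps_decomp mulrDl -rmorphM p0b rmorph1 /s /h mulrN opprK.
  by rewrite -mulrA [_ * fpsC b]mulrC.
have sn i n : (i < n)%N -> (s ^+ n) i = 0.
  by move=> lt_in; rewrite exprMn; apply: coef_fpsXn_lt.
pose g n := \sum_(i < n.+1) s ^+ i.
have gE n m : (n <= m)%N -> g m n = g n n.
  move=> /subnK <-; elim: (m - n)%N => // k IHk.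
  rewrite addSn /g big_ord_recr.
  by rewrite coef_fpsD -/(g _) sn ?ltnS ?leq_addl // addr0.
exists (fpsC b * Fps (fun n => g n n)); rewrite mulrA pbE.
apply/fpsP => n; transitivity (((1 - s) * g n) n).
  by apply: eq_bigr => i _ /=; rewrite (gE (n - i)%N n) ?leq_subr.
rewrite /g -[1 - s]opprB mulNr -subrX1 opprB.
by rewrite coef_fpsB sn // subr0.
Qed.

End FpsTheory.

Section FpsMap.
Variables (A B : comNzRingType) (f : {rmorphism A -> B}).

Lemma fps_map_zmod_morphism : zmod_morphism (fps_map f).
Proof. by move=> p q; apply/fpsP => n /=; rewrite -rmorphB. Qed.

Lemma fps_map_monoid_morphism : monoid_morphism (fps_map f).
Proof.
split=> [|p q]; apply/fpsP => n; first by case: n => [|n] /=; rewrite ?rmorph1 ?rmorph0.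
by rewrite [LHS]/= coef_fpsM rmorph_sum; apply: eq_bigr => i _; rewrite rmorphM.
Qed.

HB.instance Definition _ :=
  GRing.isZmodMorphism.Build (fps A) (fps B) (fps_map f) fps_map_zmod_morphism.
HB.instance Definition _ :=
  GRing.isMonoidMorphism.Build (fps A) (fps B) (fps_map f) fps_map_monoid_morphism.

Lemma fps_mapC a : fps_map f (fpsC a) = fpsC (f a).
Proof. by apply/fpsP => -[|n] //=; rewrite rmorph0. Qed.

Lemma fps_mapX : fps_map f (@fpsX A) = @fpsX B.
Proof. by apply/fpsP => n /=; rewrite rmorph_nat. Qed.

End FpsMap.

(** [mps r A] is A[[x_1, ..., x_r]]; [mps 2 A] and [mps 3 A] are convertible to
    [ps2 A] and [ps3 A]. *)
Fixpoint mps (r : nat) (A : comNzRingType) : comNzRingType :=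
  if r is r'.+1 then fps (mps r' A) : comNzRingType else A.

Fixpoint mpsC r (A : comNzRingType) : {rmorphism A -> mps r A} :=
  match r with
  | 0%N => idfun
  | r'.+1 => @fpsC (mps r' A) \o mpsC r' A
  end.

Fixpoint mps_map r (A B : comNzRingType) (f : {rmorphism A -> B}) :
    {rmorphism mps r A -> mps r B} :=
  match r with
  | 0%N => f
  | r'.+1 => fps_map (mps_map r' f)
  end.

Definition fps_const (A : comNzRingType) (F : fps A) : A := F 0%N.

Lemma fps_const_zmod_morphism (A : comNzRingType) : zmod_morphism (@fps_const A).
Proof. by []. Qed.

Lemma fps_const_monoid_morphism (A : comNzRingType) : monoid_morphism (@fps_const A).
Proof.
by split=> // F G; rewrite /fps_const coef_fpsM big_ord_recl big_ord0 addr0.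
Qed.

HB.instance Definition _ (A : comNzRingType) :=
  GRing.isZmodMorphism.Build (fps A) A (@fps_const A) (@fps_const_zmod_morphism A).
HB.instance Definition _ (A : comNzRingType) :=
  GRing.isMonoidMorphism.Build (fps A) A (@fps_const A) (@fps_const_monoid_morphism A).

Fixpoint mps_const r (A : comNzRingType) : {rmorphism mps r A -> A} :=
  match r with
  | 0%N => idfun
  | r'.+1 => mps_const r' A \o @fps_const (mps r' A)
  end.

(** For an ideal b this is the kernel of A[[x]] -> (A/b)[[x]], in general larger than the ideal
    generated by b. [coefs_in_gen] is the means to pass from constants in b to all of it. *)
Fixpoint coefs_in r (A : comNzRingType) (b : set A) : set (mps r A) :=
  match r return set (mps r A) with
  | 0%N => b
  | r'.+1 => [set F : fps (mps r' A) | forall n, coefs_in b (F n)]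
  end.

Section Mps.
Variables (A B : comNzRingType) (f : {rmorphism A -> B}).

Lemma mps_mapC r a : mps_map r f (mpsC r A a) = mpsC r B (f a).
Proof. by elim: r => //= r IHr; rewrite fps_mapC IHr. Qed.

Lemma mps_constC r a : mps_const r A (mpsC r A a) = a.
Proof. by elim: r. Qed.

Lemma mps_const_map r F : mps_const r B (mps_map r f F) = f (mps_const r A F).
Proof. by elim: r F => //= r IHr F; rewrite -IHr. Qed.

Lemma mps_inverse r (F : mps r A) (b : A) :
  mps_const r A F * b = 1 -> exists G, F * G = 1.
Proof.
elim: r F => [|r IHr] F; first by exists b.
by move=> /IHr[b' /fps_inverse].
Qed.

Lemma mps_map_surj r : (forall b, exists a, f a = b) ->
  forall G, exists F, mps_map r f F = G.
Proof.
move=> f_surj; elim: r => [|r IHr] //= G.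
by have [F FG] := choice (fun n => IHr (G n)); exists (Fps F); apply/fpsP.
Qed.

Lemma coefs_in_ker r F : coefs_in (f @^-1` [set 0]) F <-> mps_map r f F = 0.
Proof.
elim: r F => [|r IHr] //= F.
by split=> [F0|/fpsP F0 n]; [apply/fpsP => n; apply/IHr/F0|apply/IHr/F0].
Qed.

Lemma coefs_inM r (b c d : set A) (F G : mps r A) : is_ideal d ->
  (forall x y, b x -> c y -> d (x * y)) ->
  coefs_in b F -> coefs_in c G -> coefs_in d (F * G).
Proof.
move=> did bcd; have d0 := ideal0 did; have dD x y := @idealD _ _ x y did.
elim: r F G => [|r IHr] F G; first exact: bcd.
move=> /= bF cG n; change (coefs_in d ((F * G : fps (mps r A)) n)); rewrite coef_fpsM.
have d0' : coefs_in d (0 : mps r A) by elim: (r) => // s IHs i; apply: IHs.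
have dD' (x y : mps r A) : coefs_in d x -> coefs_in d y -> coefs_in d (x + y).
  by elim: (r) x y => //= s IHs x y dx dy i; apply: IHs.
by apply: big_ind => // i _; apply: IHr.
Qed.

Lemma coefs_inT r (F : mps r A) : coefs_in [set: A] F.
Proof. by elim: r F => //= r IHr F n; apply: IHr. Qed.

Lemma coefs_in_ideal r (b : set A) : is_ideal b -> is_ideal (@coefs_in r A b).
Proof.
move=> bid; split; first 1 last.
- elim: r => [|r IHr] F G; first exact: idealD.
  by move=> bF bG n; apply: IHr.
- move=> F G bG; apply: coefs_inM bG => //; last exact: coefs_inT.
  by move=> x y _; apply: idealMl.
- by elim: r => [|r IHr] //=; apply: ideal0.
Qed.

Lemma coefs_in_sub r (b c : set A) : b `<=` c -> @coefs_in r A b `<=` coefs_in c.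
Proof. by move=> bc; elim: r => //= r IHr F bF n; apply: IHr. Qed.

Lemma coefs_inC r (b : set A) a : is_ideal b -> b a -> coefs_in b (mpsC r A a).
Proof.
move=> bid ba; elim: r => //= r IHr [|n] //=.
by apply: ideal0; apply: coefs_in_ideal.
Qed.

Lemma coefs_in_set0 r (F : mps r A) : coefs_in [set 0] F -> F = 0.
Proof. by elim: r F => //= r IHr F F0; apply/fpsP => n; apply: IHr. Qed.

End Mps.

Lemma mps_map_comp r (A B C : comNzRingType) (f : {rmorphism A -> B})
  (g : {rmorphism B -> C}) (h : {rmorphism A -> C}) : g \o f =1 h ->
  mps_map r g \o mps_map r f =1 mps_map r h.
Proof.
by move=> gf; elim: r => //= r IHr F; apply/fpsP => n; apply: IHr.
Qed.

Section Nilpotence.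
Variables (K : fieldType) (A : localAlg K).

(** When the maximal ideal of A[[x]] is nilpotent modulo J, a power series is
    congruent to a polynomial with the same coefficients. *)
Lemma coefs_in_gen r (J : set (mps r A)) (b : set A) : is_ideal J ->
  (forall u, max_ideal (mps_const r A u) -> exists N, J (u ^+ N)) ->
  (forall a, b a -> J (mpsC r A a)) -> coefs_in b `<=` J.
Proof.
elim: r J => [|r IHr] J Jid Jnil Jb //= F bF.
have [N JN] : exists N, J (@fpsX (mps r A) ^+ N).
  by apply: Jnil; rewrite /max_ideal /= rmorph0 rmorph0.
rewrite (fps_truncE F N); apply: idealD => //; last exact: idealMr.
apply: ideal_sum => // i _; apply: idealMr => //.
apply: (IHr (@fpsC (mps r A) @^-1` J)) => //.
  by apply: ideal_preim.
move=> u mu; have [M JM] := Jnil (fpsC u) mu; exists M.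
by rewrite /= rmorphXn.
Qed.

End Nilpotence.

Lemma poly_lowest_term (S : nzRingType) (p : {poly S}) : p != 0 ->
  exists k c q, [/\ (k < size p)%N, c != 0 & p = 'X^k * (c%:P + 'X * q)].
Proof.
elim/poly_ind: p => [|p c IHp]; first by rewrite eqxx.
have [->|c0] := eqVneq c 0; last first.
  exists 0%N, c, p; split=> //; last by rewrite mul1r commr_polyX addrC.
  rewrite lt0n size_poly_eq0; apply: contraNneq c0 => /(congr1 (fun p : {poly S} => p`_0)).
  by rewrite coefD coefMX coefC coef0 add0r => ->.
rewrite addr0 => pX0; have [|k [a [q [kp a0 pE]]]] := IHp.
  by apply: contraNneq pX0 => ->; rewrite mul0r.
exists k.+1, a, q; split=> //; last by rewrite {1}pE commr_polyX exprS mulrA.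
rewrite size_mulX //; by apply: contraNneq pX0 => ->; rewrite mul0r.
Qed.

Section FiniteQuotient.
Variables (K : fieldType) (S : comNzRingType) (iota : {rmorphism K -> S}).
Variables (J : set S) (d : nat) (e : 'I_d -> S).
Hypothesis Jid : is_ideal J.
Hypothesis J_span : forall f, exists c : 'I_d -> K, J (f - \sum_i iota (c i) * e i).

(** The d + 1 powers 1, u, ..., u^d are linearly dependent modulo J. The dependency is u^k (a + u
    q(u)) with a nonzero in K and k at most d, and its second factor is a unit by hypothesis. *)
Lemma finite_quotient_nilpotent (u : S) :
  (forall a, exists b, (1 + u * a) * b = 1) -> J (u ^+ d).
Proof.
move=> u_rad; have [c cP] := choice (fun k : 'I_d.+1 => J_span (u ^+ k)).
pose C := \matrix_(k < d.+1, i < d) c k i.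
have /rowV0Pn[v /sub_kermxP vC v0] : kermx C != 0.
  by rewrite kermx_eq0 /row_free neq_ltn ltnS rank_leq_col.
have [|k [a [q [kd a0 pE]]]] := @poly_lowest_term _ (rVpoly v).
  by apply: contraNneq v0 => v0; rewrite -[v]rVpolyK v0 linear0.
have Jv : J (map_poly iota (rVpoly v)).[u].
  rewrite (@horner_coef_wide _ d.+1); last first.
    by rewrite (leq_trans (size_poly _ _)) // size_poly.
  have -> : \sum_(k < d.+1) (map_poly iota (rVpoly v))`_k * u ^+ k =
      \sum_k iota (v 0 k) * (u ^+ k - \sum_i iota (c k i) * e i).
    transitivity (\sum_k iota (v 0 k) * u ^+ k).
      by apply: eq_bigr => j _; rewrite coef_map /= coef_rVpoly_ord.
    apply/eqP; rewrite -subr_eq0 -sumrB; apply/eqP.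
    under eq_bigr do rewrite mulrBr opprB addrCA subrr addr0 mulr_sumr.
    rewrite exchange_big big1 // => i _.
    transitivity (iota ((v *m C) 0 i) * e i); last by rewrite vC mxE rmorph0 mul0r.
    rewrite mxE rmorph_sum mulr_suml; apply: eq_bigr => j _.
    by rewrite [C _ _]mxE rmorphM mulrA.
  by apply: ideal_sum => // j _; apply: idealMl.
apply: (@ideal_exprS _ _ _ k) => //.
  by rewrite -ltnS (leq_trans kd) // size_poly.
move: Jv; rewrite pE rmorphM rmorphD rmorphM /= map_polyXn map_polyX map_polyC /=.
rewrite !hornerE => Jv.
have [b ub] := u_rad (iota a^-1 * (map_poly iota q).[u]).
have -> : u ^+ k = u ^+ k * (iota a + u * (map_poly iota q).[u]) * (iota a^-1 * b).
  have : iota a * iota a^-1 = 1 by rewrite -rmorphM divff // rmorph1.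
  move: ub; set x := (map_poly _ _).[u]; set a' := iota a^-1; set a1 := iota a.
  by move=> ub aa; rewrite -[LHS]mulr1 -ub -aa; ring: aa.
exact: idealMr.
Qed.

End FiniteQuotient.

(** * Free quotients *)

Section FreeQuotient.
Variables (A S : comNzRingType) (iota : {rmorphism A -> S}) (d : nat).
Implicit Types (J : set S) (e : 'I_d -> S) (c : 'I_d -> A).

Definition lincomb e c : S := \sum_i iota (c i) * e i.

(** S/J is free over A with basis e. For A = K and S = K[[x,y]] this is convertible to the body of
    [colength], so a colength directly provides a basis. *)
Definition free_quotient J e : Prop :=
  forall f, exists! c : {ffun 'I_d -> A}, J (f - lincomb e c).

Lemma lincombD e c1 c2 : lincomb e (fun i => c1 i + c2 i) = lincomb e c1 + lincomb e c2.
Proof. by rewrite -big_split; apply: eq_bigr => i _; rewrite rmorphD mulrDl. Qed.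

Lemma lincombZ e a c : lincomb e (fun i => a * c i) = iota a * lincomb e c.
Proof. by rewrite mulr_sumr; apply: eq_bigr => i _; rewrite rmorphM mulrA. Qed.

Lemma lincombB e c1 c2 : lincomb e (fun i => c1 i - c2 i) = lincomb e c1 - lincomb e c2.
Proof. by rewrite -sumrB; apply: eq_bigr => i _; rewrite rmorphB mulrBl. Qed.

Lemma lincomb0 e : lincomb e (fun=> 0) = 0.
Proof. by rewrite /lincomb big1 // => i _; rewrite rmorph0 mul0r. Qed.

Lemma lincomb_delta e j : lincomb e (fun i => (i == j)%:R) = e j.
Proof.
rewrite /lincomb (bigD1 j) //= eqxx rmorph1 mul1r big1 ?addr0 // => i /negPf->.
by rewrite rmorph0 mul0r.
Qed.

Lemma eq_lincomb e c1 c2 : c1 =1 c2 -> lincomb e c1 = lincomb e c2.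
Proof. by move=> cE; apply: eq_bigr => i _; rewrite cE. Qed.

Lemma free_quotientP J e : is_ideal J ->
  (forall f, exists c, J (f - lincomb e c)) ->
  (forall c, J (lincomb e c) -> forall i, c i = 0) -> free_quotient J e.
Proof.
move=> Jid J_span J_free f; have [c Jc] := J_span f; exists (finfun c).
split=> [|c' Jc']; first by rewrite (eq_lincomb _ (ffunE c)).
apply/ffunP => i; rewrite ffunE; apply/eqP; rewrite -subr_eq0; apply/eqP.
apply: (J_free (fun i => c i - c' i)); rewrite lincombB.
apply: idealBT Jc' => //; exact: idealBC.
Qed.

Variables (J : set S) (e : 'I_d -> S).
Hypotheses (Jid : is_ideal J) (Jfree : free_quotient J e).

Definition coords (f : S) : {ffun 'I_d -> A} := sval (cid (Jfree f)).

Lemma coordsP f : J (f - lincomb e (coords f)).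
Proof. by rewrite /coords; case: cid => c []. Qed.

Lemma coords_uniq f c : J (f - lincomb e c) -> coords f =1 c.
Proof.
rewrite -(eq_lincomb _ (ffunE c)) /coords; case: cid => c' [_ /= c'P] /c'P->.
exact: ffunE.
Qed.

Lemma coords_eq0 f i : J f -> coords f i = 0.
Proof. by move=> Jf; apply: (@coords_uniq _ (fun=> 0)); rewrite lincomb0 subr0. Qed.

Lemma coordsD f g i : coords (f + g) i = coords f i + coords g i.
Proof.
apply: (@coords_uniq _ (fun i => coords f i + coords g i)); rewrite lincombD.
by rewrite opprD addrACA; apply: idealD => //; apply: coordsP.
Qed.

Lemma coordsZ a f i : coords (iota a * f) i = a * coords f i.
Proof.
apply: (@coords_uniq _ (fun i => a * coords f i)); rewrite lincombZ -mulrBr.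
by apply: idealMl => //; apply: coordsP.
Qed.

Lemma coordsB f g i : coords (f - g) i = coords f i - coords g i.
Proof.
by rewrite -[- g]mulN1r -(rmorphN1 iota) coordsD coordsZ mulN1r.
Qed.

Lemma coords0 i : coords 0 i = 0.
Proof. by apply: coords_eq0; apply: ideal0. Qed.

Lemma coords_sum (T : Type) (r : seq T) (F : T -> S) i :
  coords (\sum_(x <- r) F x) i = \sum_(x <- r) coords (F x) i.
Proof.
by elim/big_rec2: _ => [|x a b _ <-]; rewrite ?coords0 ?coordsD.
Qed.

Lemma coords_eqP f : (forall i, coords f i = 0) -> J f.
Proof.
move=> f0; have := coordsP f.
by rewrite (_ : lincomb _ _ = 0) ?subr0 // -[RHS](lincomb0 e); apply: eq_lincomb.
Qed.

Lemma coords_lincomb c : coords (lincomb e c) =1 c.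
Proof. by apply: coords_uniq; rewrite subrr; apply: ideal0. Qed.

(** The set is b S + J: multiplication by f acts on coordinates through a matrix over A, and so
    preserves coordinates in b. *)
Lemma coords_ideal (b : set A) : is_ideal b ->
  is_ideal [set f | forall i, b (coords f i)].
Proof.
move=> bid; split=> /= [i|f g bf bg i|f g bg i].
- by rewrite coords0; apply: ideal0.
- by rewrite coordsD; apply: idealD.
have -> : coords (f * g) i = \sum_j coords g j * coords (f * e j) i.
  under eq_bigr do rewrite -coordsZ.
  rewrite -coords_sum; apply/eqP; rewrite -subr_eq0 -coordsB coords_eq0 //.
  have -> : \sum_j iota (coords g j) * (f * e j) = f * lincomb e (coords g).
    by rewrite mulr_sumr; apply: eq_bigr => j _; rewrite mulrCA.
  by rewrite -mulrBr; apply: idealMl => //; apply: coordsP.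
by apply: ideal_sum => // j _; apply: idealMr.
Qed.

Lemma bilinear_mod_sum (N P : lmodType A) (b : N -> S -> P) n (r : seq 'I_d) F :
  bilinear_mod iota J b -> b n (\sum_(i <- r) F i) = \sum_(i <- r) b n (F i).
Proof.
case=> _ bD _ bZ _.
elim/big_rec2: _ => [|i a s _ <-]; last by rewrite bD.
by have := bZ 0 n 0; rewrite rmorph0 mul0r scale0r.
Qed.

(** An element of N (x) S/J is determined by its d coordinates in N, given by the bilinear maps
    sending (n, s) to [coords s j *: n]. Testing against these in N' and using injectivity makes the
    coordinates in N vanish. *)
Lemma free_quotient_flat : flat_quotient iota J.
Proof.
move=> N N' f f_inj u u0 P b b_bil; have [bD bD' bZl bZr bJ] := b_bil.
have c0 j : \sum_(p <- u) coords p.2 j *: p.1 = 0.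
  apply: f_inj; rewrite raddf0 raddf_sum.
  have := u0 N' (fun n s => coords s j *: n); rewrite big_map /= => u0'.
  under eq_bigr do rewrite linearZ /=.
  apply: u0'.
  split=> [m n s|n s t|a n s|a n s|n s Js].
  - exact: scalerDr.
  - by rewrite coordsD scalerDl.
  - by rewrite !scalerA mulrC.
  - by rewrite coordsZ scalerA.
  - by rewrite coords_eq0 // scale0r.
have bB n s : b n s = \sum_j b (coords s j *: n) (e j).
  transitivity (b n (lincomb e (coords s))).
    rewrite -{1}[s](subrK (lincomb e (coords s))) bD' bJ ?add0r //.
    exact: coordsP.
  by rewrite bilinear_mod_sum //; apply: eq_bigr => j _; rewrite bZr bZl.
under eq_bigr do rewrite bB.
rewrite exchange_big big1 // => j _.
have b0 s : b 0 s = 0 by have := bZl 0 0 s; rewrite !scale0r.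
transitivity (b (\sum_(p <- u) coords p.2 j *: p.1) (e j)); last by rewrite c0 b0.
by elim/big_rec2: _ => [|p x y _ ->]; rewrite ?b0 ?bD.
Qed.

End FreeQuotient.

(** * Deformations over artinian algebras are free *)

Section Socle.
Variables (K : fieldType) (A : localAlg K).

(** The annihilator of m, the largest submodule of A on which A acts through K. Its inclusion in A
    is the only injection on which flatness gets tested. *)
Definition socle_pred : {pred A^o} :=
  [pred a : A^o | `[< forall y : A, max_ideal y -> y * (a : A) = 0 >]].

Lemma socle_submod_closed : submod_closed socle_pred.
Proof.
split=> [|a x y /asboolP sx /asboolP sy].
  by apply/asboolP => y _; rewrite mulr0.
apply/asboolP => z mz; rewrite mulrDr sy // addr0.
by rewrite [a *: x]/(a * x : A) mulrCA sx // mulr0.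
Qed.

HB.instance Definition _ :=
  GRing.isSubmodClosed.Build A A^o socle_pred socle_submod_closed.

Record socle := Socle { socle_val :> A^o; socle_valP : socle_val \in socle_pred }.

HB.instance Definition _ := [isSub for socle_val].
HB.instance Definition _ := [Choice of socle by <:].
HB.instance Definition _ := [SubChoice_isSubLmodule of socle by <:].

Lemma socle_scale (a : A) (n : socle) : a *: n = (residue a)%:A *: n.
Proof.
apply: val_inj; apply/eqP; rewrite !linearZ /= -subr_eq0 -scalerBl; apply/eqP.
have /asboolP := socle_valP n; apply; exact: max_ideal_residueB.
Qed.

End Socle.

Section Deformations.
Variables (K : fieldType) (A : artAlg K) (r d : nat).
Variables (I : set (mps r K)) (e : 'I_d -> mps r K).
Hypotheses (Iid : is_ideal I) (Ifree : free_quotient (mpsC r K) I e).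

Notation m := (@max_ideal K A).
Notation mps_res := (mps_map r (@residue K A)).
Notation iota := (mpsC r A).

(** Coefficients are lifted as constants, so the lifted basis is compatible with every change of B
    and coordinates over different algebras can be compared. *)
Definition lift_family (B : localAlg K) (i : 'I_d) : mps r B := mps_map r (in_alg B) (e i).
Notation eA := (lift_family A).

Lemma mps_res_lift i : mps_res (eA i) = e i.
Proof.
have /= -> := @mps_map_comp r _ _ _ (in_alg A) (@residue K A) idfun (@residueC K A) (e i).
by elim: (r) (e i) => //= s IHs F; apply/fpsP => n; apply: IHs.
Qed.

Lemma mps_res_lincomb (c : 'I_d -> A) :
  mps_res (lincomb iota eA c) = lincomb (mpsC r K) e (fun i => residue (c i)).
Proof.
rewrite rmorph_sum; apply: eq_bigr => i _.
by rewrite rmorphM mps_res_lift mps_mapC.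
Qed.

Lemma mps_res_surj F : exists G, mps_res G = F.
Proof. by apply: mps_map_surj; apply: residue_surj. Qed.

Lemma mps_res_eq0 F : mps_res F = 0 <-> coefs_in m F.
Proof. exact: iff_sym (coefs_in_ker _ _). Qed.

Section Point.
Variable J : set (mps r A).
Hypotheses (Jid : is_ideal J) (J_res : mps_res @` J = I).

Lemma mps_res_ideal f : J f -> I (mps_res f).
Proof. by rewrite -J_res => Jf; exists f. Qed.

Lemma lift_ideal g : I g -> exists2 f, J f & mps_res f = g.
Proof. by rewrite -J_res => -[f]; exists f. Qed.

Lemma finite_quotient_local u : mps_const r K u = 0 -> I (u ^+ d).
Proof.
move=> u0; apply: (finite_quotient_nilpotent Iid (iota := mpsC r K) (e := e)) => [f|a].
  by have [c [Ic _]] := Ifree f; exists c.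
apply: (@mps_inverse _ r _ 1).
by rewrite rmorphD rmorph1 rmorphM /= u0 mul0r addr0 mulr1.
Qed.

Lemma coefs_in_max_exp (F : mps r A) n : coefs_in m F -> coefs_in (ideal_exp m n) (F ^+ n).
Proof.
move=> mF; elim: n => [|n IHn].
  by apply: (coefs_in_sub _ (@coefs_inT _ _ _)) => // a _; apply: ideal_exp0.
rewrite exprS; apply: coefs_inM mF IHn; first exact: ideal_exp_ideal.
by move=> x y; apply: ideal_exp_mulS.
Qed.

(** Modulo J, u may be replaced by u - f, where f in J lifts the residue of u. The coefficients of u
    - f lie in m, so those of its Q-th power lie in m^Q = 0. *)
Lemma deform_nilpotent_pow u : I (mps_res u) -> exists N, J (u ^+ N).
Proof.
move=> /lift_ideal[f Jf fu]; have [Q mQ] := @artinian_nilpotent K A.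
exists Q; have Jcong : J (u ^+ Q - (u - f) ^+ Q).
  by apply: ideal_congX => //; rewrite opprB addrCA subrr addr0.
apply/(ideal_cong Jid Jcong).
have -> : (u - f) ^+ Q = 0; last exact: ideal0.
apply: coefs_in_set0; apply: coefs_in_sub mQ _ _.
by apply: coefs_in_max_exp; apply/mps_res_eq0; rewrite rmorphB fu subrr.
Qed.

Lemma deform_nilpotent u : max_ideal (mps_const r A u) -> exists N, J (u ^+ N).
Proof.
move=> mu; have [|N JN] := @deform_nilpotent_pow (u ^+ d).
  rewrite rmorphXn; apply: finite_quotient_local.
  by rewrite mps_const_map.
by exists (d * N)%N; rewrite exprM.
Qed.

(** Nakayama for the nilpotent ideal m, climbing the filtration by its powers; j counts the steps
    left before the powers vanish. The combination for f is corrected at each step by one with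
    coefficients in the next power. *)
Lemma deform_span_aux j k f : (forall a, ideal_exp m (j + k) a -> a = 0) ->
  coefs_in (ideal_exp m k) f ->
  exists c, (forall i, ideal_exp m k (c i)) /\ J (f - lincomb iota eA c).
Proof.
elim: j k f => [|j IHj] k f mjk mf.
  exists (fun=> 0); split=> [i|]; first by apply: ideal0; apply: ideal_exp_ideal.
  rewrite lincomb0 subr0 (_ : f = 0); first exact: ideal0.
  exact: coefs_in_set0 (coefs_in_sub mjk mf).
(* The series that the basis represents modulo J up to an error with coefficients in m^(k+1). As V
   is an ideal containing J, [coefs_in_gen] reduces the claim on f to constants in m^k. *)
pose V : set (mps r A) := [set f | exists c g, [/\ forall i, ideal_exp m k (c i),
  coefs_in (ideal_exp m k.+1) g & J (f - (lincomb iota eA c + g))]].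
have mkid i := @ideal_exp_ideal _ m i.
have mkid' i := @coefs_in_ideal A r _ (mkid i).
have V0 f' : J f' -> V f'.
  move=> Jf; exists (fun=> 0), 0; rewrite lincomb0 addr0 subr0; split=> //.
    by move=> i; apply: ideal0.
  exact: ideal0.
have VD f1 f2 : V f1 -> V f2 -> V (f1 + f2).
  move=> [c1 [g1 [mc1 mg1 J1]]] [c2 [g2 [mc2 mg2 J2]]].
  exists (fun i => c1 i + c2 i), (g1 + g2).
  split=> [i||]; [exact: (idealD (mkid k))|exact: (idealD (mkid' _))|].
  by rewrite lincombD addrACA opprD addrACA; apply: idealD.
have VC a f' : ideal_exp m k a -> V (iota a * f').
  move=> ma; have [c [Ic _]] := Ifree (mps_res f').
  have [g Jg gE] := lift_ideal Ic.
  exists (fun i => a * (c i)%:A), (iota a * (f' - lincomb iota eA (fun i => (c i)%:A) - g)).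
  split=> [i||]; first exact: (idealMr _ (mkid k)).
    apply: (@coefs_inM _ _ (ideal_exp m k) m).
    - exact: mkid.
    - by move=> x y mx my; rewrite mulrC; apply: ideal_exp_mulS.
    - by apply: coefs_inC.
    apply/mps_res_eq0; rewrite !rmorphB mps_res_lincomb gE.
    by rewrite (eq_lincomb _ _ (fun i => residueC A (c i))) subrr.
  rewrite lincombZ -mulrDr -mulrBr; apply: idealMl => //.
  by rewrite addrA addrCA subrr addr0 opprB addrCA subrr addr0.
have Vid : is_ideal V.
  split=> // [|s f' [c [g [mc mg Jf]]]]; first by apply: V0; apply: ideal0.
  have -> : s * f' = s * lincomb iota eA c + (s * g + s * (f' - (lincomb iota eA c + g))).
    by rewrite -!mulrDr; congr (s * _); rewrite addrA addrCA subrr addr0.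
  apply: (VD).
    rewrite mulr_sumr; apply: (@big_ind _ V) => [|//|i _]; first by apply: V0; apply: ideal0.
    by rewrite mulrCA; apply: VC.
  apply: (VD); last by apply: V0; apply: idealMl.
  exists (fun=> 0), (s * g); rewrite lincomb0 add0r subrr; split.
  - by move=> i; apply: ideal0.
  - exact: (idealMl _ (mkid' _)).
  - exact: ideal0.
have [c [g [mc mg Jf]]] : V f.
  apply: (@coefs_in_gen K A r V _ Vid _ _ f mf) => [u /deform_nilpotent[N JN]|a ma].
    by exists N; apply: V0.
  by rewrite -[iota a]mulr1; apply: VC.
have [|c' [mc' Jg]] := IHj k.+1 g _ mg; first by rewrite addnS -addSn.
exists (fun i => c i + c' i); split=> [i|].
  by apply: (idealD (mkid k)) => //; apply: ideal_expS.
rewrite lincombD; apply: (idealBT Jid Jf).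
by rewrite opprD addrACA subrr add0r.
Qed.

Lemma deform_span f : exists c, J (f - lincomb iota eA c).
Proof.
have [Q mQ] := @artinian_nilpotent K A.
have [| |c [_ Jc]] := @deform_span_aux Q 0 f; last by exists c.
  by rewrite addn0.
by apply: (coefs_in_sub _ (coefs_inT f)) => a _; apply: ideal_exp0.
Qed.

(** Spanning is [deform_span]; flatness gives independence. Relations with socle coefficients are
    excluded first, and a general relation is brought to that case by multiplying it by powers of
    m. *)
Lemma flat_free_quotient : flat_quotient iota J -> free_quotient iota J eA.
Proof.
move=> Jflat; apply: free_quotientP Jid deform_span _ => c Jc.
(* The relation says that the sum of the c'_i (x) e_i dies in A (x) S/J, hence already in socle (x)
   S/J. There the K-coordinates of residues define a bilinear map, which picks out c'_j. *)
have socle_c (c' : 'I_d -> A) : (forall i, (c' i : A^o) \in @socle_pred K A) ->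
    J (lincomb iota eA c') -> forall i, c' i = 0.
  move=> sc Jc' j; pose n i : @socle K A := Socle (sc i).
  pose b (n : @socle K A) (s : mps r A) := (coords Ifree (mps_res s) j)%:A *: n.
  have b_bil : bilinear_mod iota J b.
    split=> [n1 n2 s|n1 s t|a n1 s|n1 a s|n1 s Js].
    - exact: scalerDr.
    - by rewrite /b rmorphD coordsD // !scalerDl.
    - by rewrite /b !scalerA mulrC.
    - rewrite /b rmorphM mps_mapC coordsZ // [in RHS]socle_scale scalerA.
      by rewrite -scalerAl mul1r scalerA.
    - by rewrite /b coords_eq0 ?scale0r //; apply: mps_res_ideal.
  pose val_lin : {linear @socle K A -> A^o} := \val.
  pose u := [seq (n i, eA i) | i <- index_enum 'I_d].
  have := @Jflat (@socle K A) A^o val_lin val_inj u.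
  have u0 : tensor_eq0 iota J [seq (val_lin p.1, p.2) | p <- u].
    move=> P b' b'_bil; have [_ _ bZl bZr bJ] := b'_bil.
    apply: etrans (bJ 1 _ Jc'); rewrite -map_comp big_map (bilinear_mod_sum _ _ _ b'_bil).
    by apply: eq_bigr => i _ /=; rewrite bZr -bZl [_ *: _]mulr1.
  move=> /(_ u0 _ _ b_bil); rewrite big_map (bigD1 j) //= big1 ?addr0.
    rewrite /b mps_res_lift -(lincomb_delta (mpsC r K) e j) coords_lincomb // eqxx.
    by rewrite scale1r scale1r => /(congr1 val).
  move=> i ij; rewrite /b mps_res_lift -(lincomb_delta (mpsC r K) e i) coords_lincomb //.
  by rewrite eq_sym (negPf ij) scale0r scale0r.
have [Q mQ] := @artinian_nilpotent K A.
(* Descent from m^Q = 0: if m^(Q-k) kills c and x is in m^(Q-k-1), then m kills x c, so [socle_c]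
   applies to x c. At k = Q the multiplier 1 is allowed. *)
suff kill k : (k <= Q)%N -> forall x, ideal_exp m (Q - k) x -> forall i, x * c i = 0.
  by move=> i; rewrite -[c i]mul1r (kill Q) // subnn; apply: ideal_exp0.
elim: k => [|k IHk] kQ x mx i; first by rewrite (mQ x) ?mul0r // -(subn0 Q).
apply: (socle_c (fun i => x * c i)); last by rewrite lincombZ; apply: idealMl.
move=> l; apply/asboolP => y my; rewrite mulrA IHk //; first exact: ltnW.
by rewrite -subnSK //; apply: ideal_exp_mulS.
Qed.

Hypothesis Jfree : free_quotient iota J eA.

Lemma residue_coords f i :
  residue (coords Jfree f i) = coords Ifree (mps_res f) i.
Proof.
rewrite (coords_uniq Ifree (c := fun i => residue (coords Jfree f i))) //.
by rewrite -mps_res_lincomb -rmorphB; apply: mps_res_ideal; apply: coordsP.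
Qed.

(** [coefs_in_gen] applied to the ideal b S + J of [coords_ideal]. It serves with b the kernel of a
    base change and with b a power of m. *)
Lemma coords_in_ideal (b : set A) f : is_ideal b -> coefs_in b f ->
  forall i, b (coords Jfree f i).
Proof.
move=> bid; apply: (coefs_in_gen (coords_ideal Jid Jfree bid)) => [u mu|a ba i].
  have [N JN] := deform_nilpotent mu; exists N => i.
  by rewrite coords_eq0 //; apply: ideal0.
by rewrite -[iota a]mulr1 coordsZ //; apply: idealMr.
Qed.

End Point.
End Deformations.

(** * Graphs *)

Section TruncatedEvaluation.
Variables (S T : comNzRingType) (phi : {rmorphism S -> T}) (u : T) (N : nat).
Implicit Types F G : fps S.

(** Truncation makes F(u) meaningful in any ring, at the price of being multiplicative only modulo
    an ideal containing u^N. That ideal is J on a graph, where u is nilpotent modulo J, and m^N in a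
    complete algebra. *)
Definition trunc_eval F : T := \sum_(i < N) phi (F i) * u ^+ i.

Lemma trunc_eval_zmod_morphism : zmod_morphism trunc_eval.
Proof.
move=> F G; rewrite /trunc_eval -sumrB; apply: eq_bigr => i _.
by rewrite rmorphB mulrBl.
Qed.

HB.instance Definition _ :=
  GRing.isZmodMorphism.Build (fps S) T trunc_eval trunc_eval_zmod_morphism.

Lemma trunc_evalCM s F : trunc_eval (fpsC s * F) = phi s * trunc_eval F.
Proof.
by rewrite mulr_sumr; apply: eq_bigr => i _; rewrite coef_fpsCM rmorphM mulrA.
Qed.

Lemma trunc_evalM (J : set T) F G : is_ideal J -> J (u ^+ N) ->
  J (trunc_eval (F * G) - trunc_eval F * trunc_eval G).
Proof.
move=> Jid JN.
(* The two terms differ by the single overflowing monomial, the last kept coefficient of [H] times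
   u^N. *)
have evXM H : J (trunc_eval (@fpsX S * H) - u * trunc_eval H).
  rewrite /trunc_eval; case: (N) JN => [|n] JN.
    by rewrite !big_ord0 mulr0 subrr; apply: ideal0.
  rewrite big_ord_recl coef_fpsXM rmorph0 mul0r add0r.
  rewrite [X in u * X]big_ord_recr mulrDr mulr_sumr opprD addrA -sumrB.
  rewrite big1 => [|i _]; last by rewrite coef_fpsXM /= [X in _ - X]mulrCA -exprS subrr.
  by rewrite sub0r; apply: idealN => //; rewrite mulrCA -exprS; apply: idealMl.
have evXnM n H : J (trunc_eval (@fpsX S ^+ n * H) - u ^+ n * trunc_eval H).
  elim: n => [|n IHn]; first by rewrite !mul1r subrr; apply: ideal0.
  rewrite !exprS -!mulrA; apply: (idealBT Jid (evXM _)).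
  by rewrite -mulrBr; apply: idealMl.
rewrite {1}(fps_truncE F N) mulrDl raddfD /= mulr_suml raddf_sum mulr_suml.
rewrite addrAC -sumrB; apply: idealD => //.
  apply: ideal_sum => // i _; rewrite -!mulrA [X in J (X - _)]trunc_evalCM -mulrBr.
  exact: idealMl.
rewrite -mulrA /trunc_eval big1 => [|i _]; first exact: ideal0.
by rewrite coef_fpsXn_lt ?rmorph0 ?mul0r.
Qed.

End TruncatedEvaluation.

Lemma trunc_evalC (S T : comNzRingType) (phi : {rmorphism S -> T}) u N s :
  trunc_eval phi u N.+1 (fpsC s) = phi s.
Proof.
rewrite /trunc_eval big_ord_recl /= mulr1 big1 ?addr0 // => i _.
by rewrite rmorph0 mul0r.
Qed.

Lemma trunc_evalX (S T : comNzRingType) (phi : {rmorphism S -> T}) u N :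
  trunc_eval phi u N.+2 (@fpsX S) = u.
Proof.
rewrite /trunc_eval 2!big_ord_recl big1 => [|i _]; last by rewrite rmorph0 mul0r.
by rewrite /= rmorph0 rmorph1 mul0r mul1r add0r addr0 expr1.
Qed.

Section Graph.
Variables (S : comNzRingType) (J : set S) (u : S).
Hypotheses (Jid : is_ideal J) (Jnil : exists N, J (u ^+ N)).

Let G := ideal_gen (@fpsC S @` J `|` [set @fpsX S - fpsC u]).

Let Gid : is_ideal G. Proof. exact: ideal_gen_ideal. Qed.

Let GC f : J f -> G (fpsC f).
Proof. by move=> Jf; apply: sub_ideal_gen; left; exists f. Qed.

Let GX n : G (@fpsX S ^+ n - fpsC (u ^+ n)).
Proof.
rewrite rmorphXn; apply: (ideal_congX _ Gid).
by apply: sub_ideal_gen; right.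
Qed.

Lemma graph_gen_reduce F : exists f, G (F - fpsC f).
Proof.
have [N JN] := Jnil; exists (\sum_(i < N) F i * u ^+ i).
rewrite {1}(fps_truncE F N) addrAC; apply: (idealD Gid); last first.
  apply: (idealMr _ Gid); apply/(ideal_cong Gid (GX N)).
  exact: GC.
rewrite rmorph_sum -sumrB; apply: (ideal_sum _ Gid) => i _.
by rewrite rmorphM -mulrBr; apply: (idealMl _ Gid).
Qed.

(** Substituting u for the variable is a retraction onto S modulo J which sends the generators of
    the graph ideal into J. *)
Lemma graph_genC f : G (fpsC f) <-> J f.
Proof.
(* Two extra terms make the truncated evaluation exact on constants and on the variable. *)
split=> [|/GC//]; have [N0 JN0] := Jnil; set N := N0.+2.
have JN : J (u ^+ N) by exact: (@ideal_exprS _ J u N0 N Jid (leqW (leqnSn _)) JN0).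
pose ev := trunc_eval idfun u N.
have evid : is_ideal [set F | J (ev F)].
  split=> /= [|F1 F2 J1 J2|F1 F2 J2].
  - by rewrite /ev raddf0; apply: ideal0.
  - by rewrite /ev raddfD; apply: idealD.
  - by rewrite /ev (ideal_cong Jid (trunc_evalM idfun F1 F2 Jid JN)); apply: idealMl.
move=> /(_ _ evid) /=; rewrite /ev trunc_evalC; apply=> _ [[g Jg <-]|->] /=.
  by rewrite trunc_evalC.
by rewrite raddfB /= trunc_evalC trunc_evalX subrr; apply: ideal0.
Qed.

Lemma graph_gen_free (A : comNzRingType) (iota : {rmorphism A -> S}) d (e : 'I_d -> S) :
  free_quotient iota J e ->
  free_quotient (@fpsC S \o iota) G (fun i => fpsC (e i)).
Proof.
move=> Jfree F; have [f Ff] := graph_gen_reduce F.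
have E (c : 'I_d -> A) : lincomb (@fpsC S \o iota) (fun i => fpsC (e i)) c
    = fpsC (lincomb iota e c).
  by rewrite rmorph_sum; apply: eq_bigr => i _; rewrite rmorphM.
have FP (c : 'I_d -> A) : G (F - lincomb (@fpsC S \o iota) (fun i => fpsC (e i)) c) <->
    J (f - lincomb iota e c).
  rewrite -graph_genC rmorphB E; apply: ideal_cong => //.
  by rewrite opprB addrA subrK.
have [c [Jc c_uniq]] := Jfree f; exists c.
by split=> [|c' /FP/c_uniq//]; apply/FP.
Qed.

End Graph.

Section GraphIdeal.
Variables (A : comNzRingType) (c : A) (h : ps2 A) (J : set (ps2 A)).

Lemma graph_idealE : graph_ideal c h J =
  ideal_gen (@fpsC (ps2 A) @` J `|` [set @fpsX (ps2 A) - fpsC (h - ps2C c)]).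
Proof.
by rewrite /graph_ideal /coord3_z /ps3C rmorphB opprB addrA.
Qed.

Lemma graph_ideal_ideal : is_ideal (graph_ideal c h J).
Proof. exact: ideal_gen_ideal. Qed.

Lemma graph_ideal_z : graph_ideal c h J (coord3_z c - fpsC h).
Proof. by apply: sub_ideal_gen; right. Qed.

Hypotheses (Jid : is_ideal J) (Jnil : exists N, J ((h - ps2C c) ^+ N)).

Lemma graph_idealC f : graph_ideal c h J (fpsC f) <-> J f.
Proof. by rewrite graph_idealE graph_genC. Qed.

Lemma graph_ideal_reduce F : exists f, graph_ideal c h J (F - fpsC f).
Proof. by rewrite graph_idealE; apply: graph_gen_reduce. Qed.

Lemma graph_ideal_congr v : J (h - v) -> graph_ideal c v J = graph_ideal c h J.
Proof.
suff sub h1 h2 : J (h1 - h2) -> graph_ideal c h1 J `<=` graph_ideal c h2 J.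
  move=> Jhv; apply/seteqP; split; apply: sub => //; exact: idealBC.
move=> Jh; apply: ideal_gen_min => [|F [CF|->]]; first exact: ideal_gen_ideal.
  by apply: sub_ideal_gen; left.
have Gid := ideal_gen_ideal (@fpsC (ps2 A) @` J `|` [set coord3_z c - fpsC h2]).
apply: (idealBT Gid (b := fpsC h2)); first by apply: sub_ideal_gen; right.
rewrite -rmorphB; apply: sub_ideal_gen; left; exists (h2 - h1) => //.
exact: idealBC.
Qed.

End GraphIdeal.

(** * Points of the punctual Hilbert schemes *)

Lemma ps2CE (A : comNzRingType) (a : A) : ps2C a = mpsC 2 A a. Proof. by []. Qed.

Section GraphBaseChange.
Variables (A B : comNzRingType) (f : {rmorphism A -> B}).

Lemma mps_map_z (c : A) (h : ps2 A) : mps_map 3 f (coord3_z c - fpsC h) =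
  coord3_z (f c) - fpsC (mps_map 2 f h).
Proof.
rewrite rmorphB; congr (_ - _); last exact: (fps_mapC (mps_map 2 f)).
rewrite rmorphD; congr (_ + _); first exact: (fps_mapX (mps_map 2 f)).
exact: (mps_mapC f 3).
Qed.

Lemma graph_ideal_base_change (c : A) (h : ps2 A) (J : set (ps2 A)) :
  ideal_gen (mps_map 3 f @` graph_ideal c h J) =
  graph_ideal (f c) (mps_map 2 f h) (ideal_gen (mps_map 2 f @` J)).
Proof.
set G := graph_ideal (f c) _ _; set G0 := ideal_gen _.
have Gid : is_ideal G by exact: ideal_gen_ideal.
have G0id : is_ideal G0 by exact: ideal_gen_ideal.
have GC g : G0 (fpsC g) <-> (@fpsC (ps2 B) @^-1` G0) g by [].
apply/seteqP; split; apply: ideal_gen_min => //.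
  move=> _ [F JF <-]; apply: (@ideal_gen_min _ _ (mps_map 3 f @^-1` G) _ _ F JF).
    exact: ideal_preim.
  move=> _ [[j Jj <-]|->] /=.
    rewrite (fps_mapC (mps_map 2 f)); apply: sub_ideal_gen; left.
    by exists (mps_map 2 f j) => //; apply: sub_ideal_gen; exists j.
  by rewrite (mps_map_z c h); apply: sub_ideal_gen; right.
move=> _ [[g Jg <-]|->].
  apply: (@ideal_gen_min _ _ (@fpsC (ps2 B) @^-1` G0) _ _ g Jg).
    exact: ideal_preim.
  move=> _ [j Jj <-] /=; rewrite -(fps_mapC (mps_map 2 f)).
  apply: sub_ideal_gen; exists (fpsC j) => //.
  by apply: sub_ideal_gen; left; exists j.
apply: sub_ideal_gen; exists (coord3_z c - fpsC h).
  by apply: sub_ideal_gen; right.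
exact: mps_map_z.
Qed.

Lemma graph_ideal_image (c : A) (h : ps2 A) (J : set (ps2 A)) :
  (forall b, exists a, f a = b) -> is_ideal J ->
  mps_map 3 f @` graph_ideal c h J =
  graph_ideal (f c) (mps_map 2 f h) (mps_map 2 f @` J).
Proof.
move=> f_surj Jid; have surj r := @mps_map_surj _ _ f r f_surj.
rewrite -[LHS]ideal_gen_id; last exact: (ideal_image (surj 3) (graph_ideal_ideal _ _ _)).
by rewrite graph_ideal_base_change (ideal_gen_id (ideal_image (surj 2) Jid)).
Qed.

End GraphBaseChange.

Section HilbertPoints.
Variables (K : fieldType) (d : nat) (I : set (ps2 K)) (e : 'I_d -> ps2 K).
Hypotheses (Iid : is_ideal I) (Ifree : free_quotient (mpsC 2 K) I e).

Lemma hilb2_free (A : artAlg K) (J : set (ps2 A)) : hilb2 I J ->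
  free_quotient (mpsC 2 A) J (lift_family (r := 2) e A).
Proof.
by case=> Jid Jflat J_res; apply: (flat_free_quotient (r := 2) Iid Ifree).
Qed.

Lemma free_hilb2 (A : artAlg K) (J : set (ps2 A)) : is_ideal J ->
  mps_map 2 (@residue K A) @` J = I ->
  free_quotient (mpsC 2 A) J (lift_family (r := 2) e A) -> hilb2 I J.
Proof.
by move=> Jid J_res Jfree; split=> //; apply: free_quotient_flat Jfree.
Qed.

Lemma hilb2_nilpotent (A : artAlg K) (J : set (ps2 A)) (u : ps2 A) :
  hilb2 I J -> max_ideal (mps_const 2 A u) -> exists N, J (u ^+ N).
Proof.
by case=> Jid _ J_res; apply: (deform_nilpotent (r := 2) Iid Ifree Jid J_res).
Qed.

Variables (c : K) (h0 : ps2 K).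
Hypothesis h0_const : mps_const 2 K h0 = c.

Lemma center_max (A : artAlg K) (h : ps2 A) : mps_map 2 (@residue K A) h = h0 ->
  max_ideal (mps_const 2 A (h - ps2C c%:A)).
Proof.
move=> h_res; rewrite [mps_const 2 A _]rmorphB ps2CE mps_constC /max_ideal /= rmorphB /=.
by rewrite residueC -h0_const -h_res; apply: subrr.
Qed.

Lemma center_nilpotent : exists N, I ((h0 - ps2C c) ^+ N).
Proof.
exists d; apply: (finite_quotient_local (r := 2) Iid Ifree).
by rewrite rmorphB ps2CE mps_constC h0_const subrr.
Qed.

Notation e3 := (fun i => @fpsC (ps2 K) (e i)).

Lemma graph_free : free_quotient (mpsC 3 K) (graph_ideal c h0 I) e3.
Proof.
rewrite graph_idealE.
exact: (graph_gen_free Iid center_nilpotent (iota := mpsC 2 K)).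
Qed.

Lemma lift_family3 (A : artAlg K) :
  lift_family (r := 3) e3 A = fun i => fpsC (lift_family (r := 2) e A i).
Proof. by apply/funext => i; exact: (fps_mapC (mps_map 2 (in_alg A)) (e i)). Qed.

Lemma hilb3_graph (A : artAlg K) (h : ps2 A) (J : set (ps2 A)) :
  mps_map 2 (@residue K A) h = h0 -> hilb2 I J ->
  hilb3 (graph_ideal c h0 I) (graph_ideal c%:A h J).
Proof.
move=> h_res HJ; have [Jid _ J_res] := HJ; split.
- exact: graph_ideal_ideal.
- apply: (@free_quotient_flat _ _ (mpsC 3 A) d _ (lift_family (r := 3) e3 A)).
    exact: graph_ideal_ideal.
  rewrite lift_family3 graph_idealE.
  apply: (graph_gen_free Jid _ (iota := mpsC 2 A)); last exact: hilb2_free.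
  by apply: hilb2_nilpotent HJ (center_max h_res).
- rewrite [LHS](graph_ideal_image _ _ (@residue_surj K A) Jid).
  by rewrite h_res /= residueC -J_res.
Qed.

Section Point3.
Variables (A : artAlg K) (Q : set (ps3 A)).
Hypothesis HQ : hilb3 (graph_ideal c h0 I) Q.

Let J : set (ps2 A) := @fpsC (ps2 A) @^-1` Q.

Let Qid : is_ideal Q. Proof. by case: HQ. Qed.

Let Jid : is_ideal J. Proof. exact: ideal_preim. Qed.

Lemma hilb3_res F : Q F -> graph_ideal c h0 I (mps_map 3 (@residue K A) F).
Proof. by case: HQ => _ _ <- QF; exists F. Qed.

Lemma hilb3_free : free_quotient (mpsC 3 A) Q (lift_family (r := 3) e3 A).
Proof.
case: HQ => _ Qflat Q_res.
exact: (flat_free_quotient (r := 3) (graph_ideal_ideal _ _ _) graph_free).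
Qed.

Let lincombC (a : 'I_d -> A) : lincomb (mpsC 3 A) (lift_family (r := 3) e3 A) a =
  fpsC (lincomb (mpsC 2 A) (lift_family (r := 2) e A) a).
Proof.
rewrite rmorph_sum; apply: eq_bigr => i _.
by rewrite rmorphM lift_family3.
Qed.

(** J is the contraction of Q to A[[x,y]]. The basis of the central graph consists of series in x
    and y, hence so does its lift, a basis modulo Q. It is therefore also a basis of A[[x,y]]/J. *)
Lemma hilb3_slice : hilb2 I J.
Proof.
have Jfree : free_quotient (mpsC 2 A) J (lift_family (r := 2) e A).
  move=> f; have [a [Qa a_uniq]] := hilb3_free (fpsC f); exists a.
  have E (b : 'I_d -> A) : Q (fpsC f - lincomb (mpsC 3 A) (lift_family (r := 3) e3 A) b)
      <-> J (f - lincomb (mpsC 2 A) (lift_family (r := 2) e A) b).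
    by rewrite lincombC -rmorphB.
  by split=> [|b /E/a_uniq//]; apply/E.
apply: free_hilb2 => //; apply/seteqP; split.
  move=> _ [f Jf <-]; apply/(graph_idealC Iid center_nilpotent).
  by rewrite -(fps_mapC (mps_map 2 (@residue K A))); apply: hilb3_res.
(* A lift f of g need not lie in J. Subtracting its combination of basis elements puts it there
   without changing the residue, because the coordinates of f reduce to those of g, which vanish. *)
move=> g Ig; have [f fg] := @mps_res_surj K A 2 g.
pose a := coords Jfree f; have Ja := coordsP Jfree f.
exists (f - lincomb (mpsC 2 A) (lift_family (r := 2) e A) a) => //.
rewrite rmorphB (mps_res_lincomb (r := 2)) fg (_ : lincomb _ _ _ = 0) ?subr0 //.
rewrite -(lincomb0 (mpsC 2 K) e); apply: eq_lincomb => i.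
rewrite -(coords_uniq Ifree (f := g) (c := fun i => residue (a i))) ?coords_eq0 //.
rewrite -fg -(mps_res_lincomb (r := 2)) -rmorphB.
apply/(graph_idealC Iid center_nilpotent).
by rewrite -(fps_mapC (mps_map 2 (@residue K A))); apply: hilb3_res.
Qed.

(** v is the expression of z in the basis modulo Q, which involves x and y only. Once z is
    eliminated, membership in Q becomes membership in the contraction J. *)
Lemma hilb3_graphE : exists v, [/\ I (mps_map 2 (@residue K A) v - h0),
  Q = graph_ideal c%:A v J & exists N, J ((v - ps2C c%:A) ^+ N)].
Proof.
have [a [Qa _]] := hilb3_free (coord3_z c%:A).
pose v := lincomb (mpsC 2 A) (lift_family (r := 2) e A) a.
move: Qa; rewrite lincombC -/v => Qv; exists v.
have Iv : I (mps_map 2 (@residue K A) v - h0).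
  apply/(graph_idealC Iid center_nilpotent); rewrite rmorphB.
  have Gid := graph_ideal_ideal c h0 I.
  apply: (idealBT Gid (b := coord3_z c)); last exact: graph_ideal_z.
  apply: (idealBC Gid); have := hilb3_res Qv.
  by rewrite (mps_map_z (@residue K A)) /= residueC.
(* v agrees with h0 only modulo I, which may be the unit ideal, so constant terms cannot be compared
   directly. Instead (v - c)^d reduces into I. *)
have Jnil : exists N, J ((v - ps2C c%:A) ^+ N).
  have [N JN] : exists N, J ((v - ps2C c%:A) ^+ d ^+ N).
    have [_ _ J_res] := hilb3_slice.
    apply: (deform_nilpotent_pow (r := 2) Jid J_res).
    rewrite rmorphXn rmorphB ps2CE mps_mapC /= residueC.
    apply/(ideal_cong Iid (b := (h0 - ps2C c) ^+ d)).
      by apply: ideal_congX => //; rewrite opprB addrA subrK.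
    apply: (finite_quotient_local (r := 2) Iid Ifree).
    by rewrite rmorphB ps2CE mps_constC h0_const subrr.
  by exists (d * N)%N; rewrite exprM.
split=> //; have Gid := graph_ideal_ideal c%:A v J.
have sub : graph_ideal c%:A v J `<=` Q.
  by apply: ideal_gen_min => // _ [[f Jf <-]|->].
apply/seteqP; split=> // F QF.
have [f Gf] := graph_ideal_reduce Jnil F.
apply/(ideal_cong Gid Gf)/(graph_idealC Jid Jnil).
by apply/(ideal_cong Qid (sub _ Gf)).
Qed.

End Point3.

(** Surjectivity makes the image of J an ideal and lets combinations over B be lifted to A.
    Surjections are all that formal smoothness asks for. *)
Lemma hilb2_base_change (A B : artAlg K) (psi : {lrmorphism A -> B})
    (J : set (ps2 A)) : (forall b, exists a, psi a = b) ->
  hilb2 I J -> hilb2 I (ideal_gen (ps2_map psi @` J)).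
Proof.
move=> psi_surj HJ; have [Jid _ J_res] := HJ; have Jfree := hilb2_free HJ.
have surj := @mps_map_surj _ _ psi 2 psi_surj.
rewrite ideal_gen_id; last exact: (ideal_image surj).
have res_psi : @residue K B \o psi =1 @residue K A by move=> a; apply: residue_lrmorph.
have res_map := mps_map_comp (r := 2) res_psi.
have lift_psi i : mps_map 2 psi (lift_family (r := 2) e A i) = lift_family (r := 2) e B i.
  by apply: (mps_map_comp (r := 2) (f := in_alg A)) => a; apply: rmorph_alg.
have lincomb_psi a : mps_map 2 psi (lincomb (mpsC 2 A) (lift_family (r := 2) e A) a)
    = lincomb (mpsC 2 B) (lift_family (r := 2) e B) (fun i => psi (a i)).
  by rewrite rmorph_sum; apply: eq_bigr => i _; rewrite rmorphM lift_psi (mps_mapC psi 2).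
apply: free_hilb2.
- exact: (ideal_image surj).
- apply/seteqP; split=> [_ [_ [f Jf <-] <-]|g].
    by rewrite -J_res; exists f => //; exact: esym (res_map f).
  rewrite -J_res => -[f Jf <-]; exists (mps_map 2 psi f); first by exists f.
  exact: res_map.
apply: free_quotientP; first exact: (ideal_image surj).
  move=> g; have [f <-] := surj g.
  exists (fun i => psi (coords Jfree f i)); rewrite -lincomb_psi -rmorphB.
  exists (f - lincomb (mpsC 2 A) (lift_family (r := 2) e A) (coords Jfree f)) => //.
  exact: coordsP.
move=> b; have [a ab] := choice (fun i => psi_surj (b i)).
rewrite -(eq_lincomb _ _ ab) -lincomb_psi => -[f Jf fE] i.
(* f in J and the lifted combination have the same image, so their difference has coefficients,
   hence coordinates, in the kernel of psi; these coordinates are the - a_i. *)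
have f_ker : @coefs_in 2 A (psi @^-1` [set 0])
    (f - lincomb (mpsC 2 A) (lift_family (r := 2) e A) a).
  by apply/(@coefs_in_ker _ _ psi 2); rewrite rmorphB [mps_map 2 psi f]fE subrr.
have Kid : is_ideal (psi @^-1` [set 0]) by apply: ideal_preim; apply: set10_ideal.
have := coords_in_ideal (r := 2) Iid Ifree Jid J_res Jfree Kid f_ker i.
rewrite coordsB // coords_eq0 // coords_lincomb // sub0r /= rmorphN /= => ai.
by apply: oppr_inj; rewrite oppr0 -ab.
Qed.

End HilbertPoints.

(** * Complete local algebras and their dimension *)

Section CompleteEvaluation.
Variables (K : fieldType) (R : localAlg K).
Hypothesis R_complete : adically_complete R.
Notation m := (@max_ideal K R).

Let mexp_id n : is_ideal (ideal_exp m n). Proof. exact: ideal_exp_ideal. Qed.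

Lemma complete_eq (a b : R) : (forall n, ideal_exp m n (a - b)) -> a = b.
Proof.
move=> ab; apply/eqP; rewrite -subr_eq0; apply/eqP.
by case: R_complete => + _; apply.
Qed.

Section Variable1.
Variables (S : comNzRingType) (phi : {rmorphism S -> R}) (x : R).
Hypothesis mx : m x.

Lemma fps_eval_exists (F : fps S) :
  exists a, forall n, ideal_exp m n (a - trunc_eval phi x n F).
Proof.
case: R_complete => _ /(_ (fun n => trunc_eval phi x n F)); apply=> n.
rewrite /trunc_eval big_ord_recr /= addrAC subrr add0r.
by apply: (idealMl _ (mexp_id n)); apply: ideal_exp_expr.
Qed.

Definition fps_eval (F : fps S) : R := sval (cid (fps_eval_exists F)).

Lemma fps_evalP F n : ideal_exp m n (fps_eval F - trunc_eval phi x n F).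
Proof. by rewrite /fps_eval; case: cid => a /=. Qed.

Lemma fps_eval_uniq F a : (forall n, ideal_exp m n (a - trunc_eval phi x n F)) ->
  fps_eval F = a.
Proof.
move=> aP; apply: complete_eq => n.
apply: (@idealBT _ _ (trunc_eval phi x n F) _ _ (mexp_id n)); first exact: fps_evalP.
exact: (idealBC (mexp_id n)).
Qed.

Lemma fps_eval_zmod_morphism : zmod_morphism fps_eval.
Proof.
move=> F G; apply: fps_eval_uniq => n; rewrite raddfB opprD addrACA -opprD.
by apply: (idealB (mexp_id n)); apply: fps_evalP.
Qed.

Lemma fps_evalC s : fps_eval (fpsC s) = phi s.
Proof.
apply: fps_eval_uniq => -[|n]; first exact: ideal_exp0.
by rewrite trunc_evalC subrr; apply: (ideal0 (mexp_id _)).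
Qed.

Lemma fps_evalX : fps_eval (@fpsX S) = x.
Proof.
apply: fps_eval_uniq => -[|[|n]]; first exact: ideal_exp0.
  rewrite /trunc_eval big_ord_recl big_ord0 /= rmorph0 mul0r addr0 subr0.
  by rewrite ideal_exp1 //; apply: max_ideal_ideal.
by rewrite trunc_evalX subrr; apply: (ideal0 (mexp_id _)).
Qed.

Lemma fps_eval_monoid_morphism : monoid_morphism fps_eval.
Proof.
split=> [|F G]; first by rewrite -(rmorph1 (@fpsC S)) fps_evalC rmorph1.
apply: fps_eval_uniq => n; have Jid := mexp_id n.
have := trunc_evalM phi F G Jid (@ideal_exp_expr _ m x n mx).
move/(idealBC Jid); apply: (idealBT Jid).
rewrite -(subrKA (trunc_eval phi x n F * fps_eval G)) -mulrBl -mulrBr.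
by apply: (idealD Jid); [apply: (idealMr _ Jid)|apply: (idealMl _ Jid)]; apply: fps_evalP.
Qed.

HB.instance Definition _ :=
  GRing.isZmodMorphism.Build (fps S) R fps_eval fps_eval_zmod_morphism.
HB.instance Definition _ :=
  GRing.isMonoidMorphism.Build (fps S) R fps_eval fps_eval_monoid_morphism.

End Variable1.

Variable x : nat -> R.
Hypothesis mx : forall i, m (x i).

Fixpoint mps_eval r : {rmorphism mps r K -> R} :=
  match r with
  | 0%N => in_alg R
  | r'.+1 => fps_eval (mps_eval r') (mx r')
  end.

Lemma mps_evalC r c : mps_eval r (mpsC r K c) = c%:A.
Proof. by elim: r => //= r IHr; rewrite fps_evalC. Qed.

End CompleteEvaluation.

Lemma det_trick (S : comNzRingType) (P : set S) N (M : 'M[S]_N) (g : 'I_N -> S) :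
  is_ideal P -> (forall i, P (\sum_j M i j * g j)) -> forall i, P (\det M * g i).
Proof.
move=> Pid PM i; pose G := \col_i g i.
have -> : \det M * g i = (\adj M *m (M *m G)) i 0.
  by rewrite mulmxA mul_adj_mx mul_scalar_mx !mxE.
rewrite mxE; apply: ideal_sum => // j _; apply: idealMl => //.
rewrite mxE; under eq_bigr do rewrite [G _ _]mxE.
exact: PM.
Qed.

(** Cayley-Hamilton, after cancelling the powers of y in the characteristic
    polynomial of the multiplication by y. *)
Lemma module_finite_relation (S R : comNzRingType) (phi : {rmorphism S -> R})
  (P : set R) N (g : 'I_N -> R) (y : R) : prime_ideal P ->
  (forall t, exists s, P (t - lincomb phi g s)) -> ~ P y ->
  exists f b, f != 0 /\ P (phi f - b * y).
Proof.
case=> Pid P1 Pprime gen Py.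
have [s sP] := choice (fun i => gen (y * g i)).
pose M := \matrix_(i < N, j < N) s i j.
pose h : {rmorphism {poly S} -> R} := horner_morph (fun a => mulrC y (phi a)).
have hX : h 'X = y by apply: horner_morphX.
have hC a : h a%:P = phi a by apply: horner_morphC.
have hM : map_mx h (char_poly_mx M) = y%:M - map_mx phi M.
  by apply/matrixP => i j; rewrite !mxE rmorphB rmorphMn /= hX hC.
have Pdet i : P (h (char_poly M) * g i).
  rewrite -[h _]det_map_mx hM; apply: (det_trick (g := g) Pid) => k.
  have -> : \sum_j (y%:M - map_mx phi M) k j * g j = y * g k - lincomb phi g (s k).
    under eq_bigr do rewrite !mxE mulrBl.
    rewrite sumrB; congr (_ - _); rewrite (bigD1 k) //= eqxx big1 ?addr0 // => j.
    by rewrite eq_sym => /negPf->; rewrite mul0r.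
  exact: sP.
(* The characteristic polynomial kills the generators g_i modulo P, and 1 is a combination of
   them. *)
have Ph : P (h (char_poly M)).
  have [c Pc] := gen 1; have := idealMl (h (char_poly M)) Pid Pc.
  rewrite mulrBr mulr1 => Ph; apply/(ideal_cong Pid Ph).
  rewrite mulr_sumr; apply: (ideal_sum _ Pid) => i _; rewrite mulrCA.
  exact: (idealMl _ Pid).
have [|k [c [q [_ c0 chE]]]] := @poly_lowest_term _ (char_poly M).
  exact: monic_neq0 (char_poly_monic M).
exists c, (- h q); split=> //; rewrite mulNr opprK mulrC.
move: Ph; rewrite chE rmorphM rmorphXn rmorphD rmorphM hX hC.
elim: k {chE} => [|k IHk]; first by rewrite mul1r.
by rewrite exprS -mulrA => /Pprime[].
Qed.

Lemma fps_lowest_term (S : comNzRingType) (f : fps S) : f != 0 ->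
  exists k c f', c != 0 /\ f = @fpsX S ^+ k * (fpsC c + @fpsX S * f').
Proof.
move=> f0; have exk : exists k, f k != 0.
  apply: contrapT => nk; move/eqP: f0; apply; apply/fpsP => k.
  by apply: contrapT => /eqP fk; apply: nk; exists k.
case: (ex_minnP exk) => k fk k_min.
exists k, (f k), (iter k.+1 (@fps_shift S) f); split=> //.
rewrite {1}(fps_truncE f k) big1 ?add0r => [|i _]; last first.
  have [->|/k_min] := eqVneq (f i) 0; first by rewrite rmorph0 mul0r.
  by rewrite leqNgt ltn_ord.
congr (_ * _); rewrite {1}[iter k _ _]fps_decomp iterS; congr (fpsC _ + _).
have iterE n i : iter n (@fps_shift S) f i = f (i + n)%N.
  by elim: n i => [|n IHn] i /=; rewrite ?addn0 // IHn addSnnS.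
by rewrite iterE.
Qed.

Section Dimension.
Variables (K : fieldType) (R : localAlg K).
Hypotheses (R_complete : adically_complete R) (R_noetherian : noetherian R).
Notation m := (@max_ideal K R).

(** Ideals are closed because they are finitely generated: j is a finite combination of the
    generators of J with power series as coefficients, and evaluation respects it. *)
Lemma fps_eval_ideal (J : set R) (x : R) (mx : m x) (j : fps R) : is_ideal J ->
  (forall n, J (j n)) -> J (fps_eval R_complete idfun mx j).
Proof.
move=> /R_noetherian[s Js] Jj; have Jid : is_ideal J by rewrite Js; apply: ideal_gen_ideal.
have exc n : exists c : 'I_(size s) -> R, j n = \sum_i c i * s`_i.
  by apply: ideal_gen_seqP; rewrite -Js.
have [c cP] := choice exc.
have -> : j = \sum_i Fps (fun n => c n i) * fpsC s`_i.
  apply/fpsP => n; rewrite cP coef_fps_sum; apply: eq_bigr => i _.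
  by rewrite [X in _ = fcoef X n]mulrC coef_fpsCM mulrC.
rewrite rmorph_sum; apply: ideal_sum => // i _; rewrite rmorphM /= fps_evalC.
apply: idealMl => //; rewrite Js; apply: sub_ideal_gen.
by rewrite /= mem_nth.
Qed.

(** Adding to S a variable that maps to x removes x from the ideal modulo which
    R is finite over S. *)
Lemma module_finite_step (S : comNzRingType) (phi : {rmorphism S -> R}) (x : R)
  (mx : m x) (J : set R) N (g : 'I_N -> R) : is_ideal J ->
  (forall t, exists s t', J (t - lincomb phi g s - x * t')) ->
  forall t, exists s, J (t - lincomb (fps_eval R_complete phi mx) g s).
Proof.
move=> Jid gen t.
have [s sP] := choice gen; have [next nextP] := choice sP.
(* The division is iterated: [T] lists the successive remainders and [sigma] the coefficients
   produced. The errors, gathered in the series [j] below, lie in J, and evaluating [j] at x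
   telescopes to t minus the desired combination. *)
pose T := Fps (fun n => iter n next t).
pose sigma i := Fps (fun n => s (T n) i).
pose ev : {rmorphism fps R -> R} := fps_eval R_complete idfun mx.
have evC a : ev (fpsC a) = a by apply: fps_evalC.
have evX : ev (@fpsX R) = x by apply: fps_evalX.
exists sigma.
have evE (F : fps S) : ev (fps_map phi F) = fps_eval R_complete phi mx F.
  by apply: fps_eval_uniq => n; apply: fps_evalP.
pose j := T - \sum_i fps_map phi (sigma i) * fpsC (g i) - fpsC x * fps_shift T.
have <- : ev j = t - lincomb (fps_eval R_complete phi mx) g sigma.
  rewrite /j !rmorphB rmorph_sum {1}[T]fps_decomp rmorphD !rmorphM !evC evX.
  rewrite addrAC addrK; congr (_ - _).
  by apply: eq_bigr => i _; rewrite rmorphM evC evE.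
apply: fps_eval_ideal => // n.
have -> : j n = T n - lincomb phi g (s (T n)) - x * next (T n); last exact: nextP.
rewrite /j 2!coef_fpsB coef_fpsCM; congr (_ - _ - _).
rewrite coef_fps_sum; apply: eq_bigr => i _.
by rewrite mulrC coef_fpsCM mulrC.
Qed.

(** The ideal J + (x_a, ..., x_(b-1)). The lower index lets the parameters be released one at a
    time. *)
Definition ideal_adjoin (J : set R) (x : nat -> R) (a b : nat) : set R :=
  [set t | exists t' : nat -> R, J (t - \sum_(a <= i < b) x i * t' i)].

Lemma ideal_adjoin_ideal J x a b : is_ideal J -> is_ideal (ideal_adjoin J x a b).
Proof.
move=> Jid; split=> [|t1 t2 [u1 J1] [u2 J2]|s t [u Ju]].
- exists (fun=> 0); rewrite sub0r; apply: idealN => //; apply: ideal_sum => // i _.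
  by rewrite mulr0; apply: ideal0.
- exists (fun i => u1 i + u2 i).
  under eq_bigr do rewrite mulrDr.
  by rewrite big_split opprD addrACA; apply: idealD.
- exists (fun i => s * u i).
  under eq_bigr do rewrite mulrCA.
  by rewrite -mulr_sumr -mulrBr; apply: idealMl.
Qed.

Lemma sub_ideal_adjoin J x a b : is_ideal J -> J `<=` ideal_adjoin J x a b.
Proof.
move=> Jid t Jt; exists (fun=> 0); rewrite big1 ?subr0 // => i _; exact: mulr0.
Qed.

Lemma ideal_adjoin_mem J x a b i : is_ideal J -> (a <= i < b)%N ->
  ideal_adjoin J x a b (x i).
Proof.
move=> Jid ab; exists (fun j => (j == i)%:R).
rewrite (bigD1_seq i) ?mem_index_iota ?iota_uniq //= eqxx mulr1 big1.
  by rewrite addr0 subrr; apply: ideal0.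
by move=> j /negPf->; rewrite mulr0.
Qed.

Lemma ideal_adjoin_min J L x a b : is_ideal L -> J `<=` L ->
  (forall i, (a <= i < b)%N -> L (x i)) -> ideal_adjoin J x a b `<=` L.
Proof.
move=> Lid JL Lx t [u Ju]; apply/(ideal_cong Lid (JL _ Ju)).
rewrite big_nat; apply: ideal_sum => // i ab; apply: idealMr => //; exact: Lx.
Qed.

Definition cofinite (J : set R) : Prop :=
  exists N (g : 'I_N -> R), forall t, exists c, J (t - lincomb (in_alg R) g c).

Lemma sub_cofinite (J L : set R) : J `<=` L -> cofinite J -> cofinite L.
Proof.
move=> JL [N [g gen]]; exists N, g => t.
by have [c /JL] := gen t; exists c.
Qed.

(** The powers of x filter R modulo J, in finitely many steps since x^q is in J. As L is contained
    in J + xR, each graded piece is spanned by the x^k g_i. *)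
Lemma cofinite_pow (J L : set R) x q : is_ideal J -> J (x ^+ q) -> cofinite L ->
  (forall a, L a -> exists b, J (a - x * b)) -> cofinite J.
Proof.
move=> Jid Jxq [N [g gen]] LJ.
suff gen' k : exists M (h : 'I_M -> R), forall t, exists c b,
    J (t - lincomb (in_alg R) h c - x ^+ k * b).
  have [M [h hP]] := gen' q; exists M, h => t; have [c [b Jc]] := hP t.
  by exists c; apply/(ideal_cong Jid Jc); apply: idealMr.
elim: k => [|k [M [h hP]]].
  exists 0%N, (fun=> 0) => t; exists (fun=> 0), t.
  by rewrite lincomb0 subr0 mul1r subrr; apply: ideal0.
exists (M + N)%N, (fun i => row_mx (\row_i h i) (\row_i (x ^+ k * g i)) 0 i) => t.
have [c [b Jc]] := hP t; have [d /LJ[b' Jd]] := gen b.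
exists (fun i => row_mx (\row_i c i) (\row_i d i) 0 i), b'.
have -> : lincomb (in_alg R) (fun i => row_mx (\row_i h i) (\row_i (x ^+ k * g i)) 0 i)
    (fun i => row_mx (\row_i c i) (\row_i d i) 0 i) =
    lincomb (in_alg R) h c + x ^+ k * lincomb (in_alg R) g d.
  rewrite /lincomb big_split_ord mulr_sumr; congr (_ + _); apply: eq_bigr => i _.
    by rewrite !row_mxEl !mxE.
  by rewrite !row_mxEr !mxE mulrCA.
move: Jc; set a := lincomb _ _ c; move: Jd; set a' := lincomb _ _ d => Jd Jc.
have -> : t - (a + x ^+ k * a') - x ^+ k.+1 * b' =
  (t - a - x ^+ k * b) + x ^+ k * (b - a' - x * b') by rewrite exprS; ring.
by apply: idealD => //; apply: idealMl.
Qed.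

Section ParameterSystem.
Variables (x : nat -> R).
Hypothesis mx : forall i, m (x i).
Notation ev := (mps_eval R_complete mx).

(** At stage k the parameters x_0, ..., x_(k-1) have become variables of the coefficient ring and
    the others are still divided out. *)
Lemma module_finite_parameters (J : set R) r N (g : 'I_N -> R) : is_ideal J ->
  (forall t, exists c, ideal_adjoin J x 0 r (t - lincomb (in_alg R) g c)) ->
  forall t, exists s, J (t - lincomb (ev r) g s).
Proof.
move=> Jid gen.
suff H k : (k <= r)%N ->
    forall t, exists s, ideal_adjoin J x k r (t - lincomb (ev k) g s).
  move=> t; have [s [u]] := H r (leqnn r) t; exists s.
  by rewrite big_geq // subr0 in p.
elim: k => [_|k IHk kr] //.
apply: module_finite_step; first exact: ideal_adjoin_ideal.
move=> t; have [s [u Ju]] := IHk (ltnW kr) t.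
exists s, (u k), u; move: Ju; rewrite big_ltn //.
by rewrite opprD addrA.
Qed.

(** The curve x_i = x_0 ^ N_i meets f = 0 only at the origin when the N_i grow
    fast enough. *)
Lemma mps_eval_leading r (f : mps r K) : f != 0 -> exists (N : nat -> nat) q c a b,
  [/\ N 0%N = 1%N /\ (r = 0%N -> q = 0%N), forall i, (0 < N i)%N, c != 0 &
   ev r f = x 0%N ^+ q * (c%:A + x 0%N * a) + \sum_(0 <= i < r) (x i - x 0%N ^+ N i) * b i].
Proof.
elim: r f => [|r IHr] /= f f0.
  exists (fun=> 1%N), 0%N, f, 0, (fun=> 0).
  by rewrite big_geq // mul1r mulr0 !addr0; split.
have [k [c' [f' [c'0 ->]]]] := fps_lowest_term f0.
have [N [q [c [a [b [[N0 q0] N_gt0 c0 ev_c']]]]]] := IHr c' c'0.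
rewrite rmorphM rmorphXn rmorphD rmorphM /= fps_evalX fps_evalC ev_c'.
set a' := fps_eval _ _ _ _; set z := x r; set y := x 0%N ^+ q.+1.
pose B := \sum_(i < k) z ^+ (k.-1 - i) * y ^+ i.
have zyB : z ^+ k = y ^+ k + (z - y) * B by rewrite -subrXX addrC subrK.
(* On the curve x_r becomes x_0^(q+1), of order beyond the order q of the leading coefficient c', so
   c' + x_r f' keeps order q and the total order is (q+1)k + q. For r = 0 the new variable is x_0
   itself and q = 0, whence N_0 = 1. *)
exists (fun i => if i == r then q.+1 else N i), (q.+1 * k + q)%N, c, (a + a').
exists (fun i => if i == r then
   B * (x 0%N ^+ q * (c%:A + x 0%N * a) + \sum_(0 <= i < r) (x i - x 0%N ^+ N i) * b i
        + z * a') + y ^+ k * a' else y ^+ k * b i).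
split=> //.
- by split=> //; case: (0%N =P r) => // r0; rewrite q0.
- by move=> i; case: ifP.
rewrite big_nat_recr //= !eqxx -/z -/y.
set s := \sum_(0 <= i < r) _ * b i; set s' := \sum_(0 <= i < r) _.
have -> : s' = y ^+ k * s.
  rewrite mulr_sumr; apply: eq_big_nat => i /andP[_ ir].
  by rewrite (ltn_eqF ir) mulrCA.
rewrite zyB exprD exprM -/y.
have yE : y = x 0%N ^+ q * x 0%N by rewrite /y exprSr.
have zE : z = (z - y) + y by rewrite subrK.
move: (y ^+ k) (x 0%N ^+ q) yE zE => yk xq yE zE.
transitivity (yk * (xq * (c%:A + x 0%N * a) + y * a') + yk * s +
  (z - y) * (B * (xq * (c%:A + x 0%N * a) + s + z * a') + yk * a')); first by ring.
by rewrite {1}yE; ring.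
Qed.

Lemma cofinite_drop (P : set R) r (f : mps r K) : is_ideal P -> ~ P 1 ->
  f != 0 -> P (ev r f) -> cofinite (ideal_adjoin P x 0 r) ->
  (0 < r)%N /\ exists2 x' : nat -> R,
    forall i, m (x' i) & cofinite (ideal_adjoin P x' 0 r.-1).
Proof.
move=> Pid P1 f0 Pf cof; have mid := @max_ideal_ideal _ R.
case: r => [|r] in f f0 Pf cof *.
  case: P1; have -> : 1 = f^-1%:A * f%:A :> R.
    by rewrite -scalerAl mul1r scalerA mulVf // scale1r.
  exact: idealMl.
split=> //=.
have [N [q [c [a [b [[N0 _] N_gt0 c0 fE]]]]]] := mps_eval_leading f0.
pose x' i := x i.+1 - x 0%N ^+ N i.+1.
have mx' i : m (x' i).
  by apply: (idealB mid) => //; apply: (@ideal_exprS _ m _ 1 _ mid (N_gt0 _)); rewrite expr1.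
exists x' => //; have Jid := @ideal_adjoin_ideal P x' 0 r Pid.
have PJ := @sub_ideal_adjoin P x' 0 r Pid.
have Jx0 : ideal_adjoin P x' 0 r (x 0%N ^+ q).
  apply: (@ideal_unitl _ R _ (c%:A + x 0%N * a)) => //.
    by rewrite rmorphD rmorphM /= residueC (mx 0%N) mul0r addr0.
  rewrite mulrC; have -> : x 0%N ^+ q * (c%:A + x 0%N * a) =
      ev r.+1 f - \sum_(0 <= i < r.+1) (x i - x 0%N ^+ N i) * b i by rewrite fE addrK.
  apply: (idealB Jid); first exact: PJ.
  rewrite big_nat_recl // N0 subrr mul0r add0r big_nat; apply: (ideal_sum _ Jid) => i ir.
  by apply: (idealMr _ Jid); apply: ideal_adjoin_mem.
apply: (cofinite_pow Jid Jx0 cof) => t.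
(* P + (x') + (x_0), which contains all the old parameters since every N_i is positive. *)
pose L := [set t | exists b, ideal_adjoin P x' 0 r (t - x 0%N * b)].
have Lid : is_ideal L.
  split=> [|t1 t2 [b1 L1] [b2 L2]|s t1 [b1 L1]].
  - by exists 0; rewrite mulr0 subr0; apply: (ideal0 Jid).
  - by exists (b1 + b2); rewrite mulrDr opprD addrACA; apply: (idealD Jid).
  - by exists (s * b1); rewrite mulrCA -mulrBr; apply: (idealMl _ Jid).
have JL : ideal_adjoin P x' 0 r `<=` L.
  by move=> s Js; exists 0; rewrite mulr0 subr0.
apply: (ideal_adjoin_min Lid).
  by move=> s /PJ/JL.
have Lx0 : L (x 0%N) by exists 1; rewrite mulr1 subrr; apply: (ideal0 Jid).
move=> [|i] // ir; rewrite -(subrK (x 0%N ^+ N i.+1) (x i.+1)).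
apply: (idealD Lid); first by apply: JL; apply: ideal_adjoin_mem.
by apply: (@ideal_exprS _ L _ 1 _ Lid (N_gt0 _)); rewrite expr1.
Qed.

End ParameterSystem.

Lemma prime_chain_cofinite n r (P : nat -> set R) (x : nat -> R) :
  prime_chain n P -> (forall i, m (x i)) -> cofinite (ideal_adjoin (P 0%N) x 0 r) ->
  (n <= r)%N.
Proof.
elim: n r P x => // n IHn r P x [Pprime Pstrict] mx cof.
have Pid i : (i <= n.+1)%N -> is_ideal (P i) by move=> /Pprime[].
have [P01 /existsNP[y /not_implyP[P1y P0y]]] := Pstrict 0%N isT.
have [N [g gen]] := cof.
have gen' := module_finite_parameters mx (Pid 0%N isT) gen.
have [f [b [f0 Pf]]] := module_finite_relation (Pprime 0%N isT) gen' P0y.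
have P1f : P 1%N (mps_eval R_complete mx r f).
  by apply/(ideal_cong (Pid 1%N isT) (P01 _ Pf)); apply: idealMl => //; apply: Pid.
have P11 : ~ P 1%N 1 by have [] := Pprime 1%N isT.
have [|r_gt0 [x' mx' cof']] := cofinite_drop (Pid 1%N isT) P11 f0 P1f.
  by apply: sub_cofinite cof => t [u /P01 Pu]; exists u.
rewrite -(prednK r_gt0) ltnS; apply: (IHn r.-1 (fun i => P i.+1) x') => //.
by split=> i; [apply: (Pprime i.+1)|apply: (Pstrict i.+1)].
Qed.

End Dimension.

(** * Morphisms from a regular complete local algebra *)

Section Nakayama.
Variables (K : fieldType) (R : localAlg K).
Hypothesis R_noetherian : noetherian R.
Notation m := (@max_ideal K R).

(** Nakayama: generators s of m satisfy (1 - M) s = 0 modulo the span of e, with the entries of M in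
    m. The determinant of 1 - M has residue 1, so it is a unit. *)
Lemma max_ideal_cotangent n (e : 'I_n -> R) :
  (forall a, m a -> exists c : 'I_n -> K, ideal_exp m 2 (a - \sum_i c i *: e i)) ->
  forall a, m a -> exists b : 'I_n -> R, a = \sum_i b i * e i.
Proof.
move=> cot; have mid := @max_ideal_ideal _ R; have [s ms] := R_noetherian mid.
have m_mem (k : 'I_(size s)) : m s`_k.
  by rewrite ms; apply: sub_ideal_gen; rewrite /= mem_nth.
pose m2 := [set a | exists b : 'I_(size s) -> R,
  (forall k, m (b k)) /\ a = \sum_k b k * s`_k].
have m2P : ideal_exp m 2 `<=` m2.
  apply: ideal_exp_ind.
    split=> [|_ _ [b [mb ->]] [c [mc ->]]|a _ [b [mb ->]]].
    - exists (fun=> 0); split; first by move=> _; apply: ideal0.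
      by rewrite big1 // => i _; rewrite mul0r.
    - exists (fun i => b i + c i); split; first by move=> k; apply: idealD.
      by rewrite -big_split; apply: eq_bigr => i _; rewrite mulrDl.
    - exists (fun i => a * b i); split; first by move=> k; apply: idealMl.
      by rewrite mulr_sumr; apply: eq_bigr => i _; rewrite mulrA.
  move=> a b ma; rewrite (ideal_exp1 mid) {1}ms => /ideal_gen_seqP[q ->].
  exists (fun k => a * q k); split; first by move=> k; apply: idealMr.
  by rewrite mulr_sumr; apply: eq_bigr => i _; rewrite mulrA.
have [c cP] := choice (fun k : 'I_(size s) => cot _ (m_mem k)).
have [B BP] := choice (fun k => m2P _ (cP k)).
have Eid := span_ideal e; set E := [set a | _] in Eid *.
pose M := \matrix_(k, l) B k l.
have EM k : E (\sum_l (1%:M - M) k l * s`_l).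
  have -> : \sum_l (1%:M - M) k l * s`_l = s`_k - \sum_l B k l * s`_l.
    under eq_bigr do rewrite !mxE mulrBl.
    rewrite sumrB; congr (_ - _); rewrite (bigD1 k) //= eqxx mul1r big1 ?addr0 // => l.
    by rewrite eq_sym => /negPf->; rewrite mul0r.
  have [_ <-] := BP k; rewrite opprB addrC subrK.
  by exists (fun i => (c k i)%:A); apply: eq_bigr => i _; rewrite -scalerAl mul1r.
have detM : residue (\det (1%:M - M)) = 1.
  rewrite -det_map_mx (_ : map_mx _ _ = 1%:M) ?det1 //.
  apply/matrixP => k l; rewrite !mxE rmorphB rmorph_nat /=.
  by have [mB _] := BP k; rewrite mB subr0.
suff mE : m `<=` E by move=> a /mE.
rewrite ms; apply: ideal_gen_min => // _ /seq_tnthP[k ->].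
apply: (ideal_unitl (c := \det (1%:M - M)) Eid); first by rewrite detM oner_neq0.
by rewrite (tnth_nth 0); apply: (det_trick (g := fun k : 'I_(size s) => s`_k) Eid).
Qed.

End Nakayama.

(** The outermost variable has the highest index; an index out of range gives 0. *)
Fixpoint mps_var r (A : comNzRingType) (j : nat) : mps r A :=
  match r return mps r A with
  | 0%N => 0
  | r'.+1 => if j == r' then @fpsX (mps r' A) else @fpsC (mps r' A) (mps_var r' A j)
  end.

Lemma mps_eval_var (K : fieldType) (R : localAlg K) (Rc : adically_complete R)
  (x : nat -> R) (mx : forall i, max_ideal (x i)) r j : (j < r)%N ->
  mps_eval Rc mx r (mps_var r K j) = x j.
Proof.
elim: r => //= r IHr; rewrite ltnS leq_eqVlt; case: eqP => [->|_] /= jr.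
  by rewrite fps_evalX.
by rewrite fps_evalC IHr.
Qed.

Definition extend_ord (A : Type) (a0 : A) n (e : 'I_n -> A) (i : nat) : A :=
  oapp e a0 (insub i).

Lemma extend_ordE (A : Type) (a0 : A) n (e : 'I_n -> A) (i : 'I_n) :
  extend_ord a0 e i = e i.
Proof. by rewrite /extend_ord valK. Qed.

Section RegularLocal.
Variables (K : fieldType) (R : localAlg K).
Hypotheses (R_complete : adically_complete R) (R_noetherian : noetherian R).
Variables (n : nat) (e : 'I_n -> R).
Hypotheses (R_dim : has_krull_dim R n) (me : forall i, max_ideal (e i)).
Hypothesis e_gen : forall a, max_ideal a -> exists b : 'I_n -> R, a = \sum_i b i * e i.

Let x := extend_ord 0 e.

Let mx i : max_ideal (x i).
Proof.
rewrite /x /extend_ord; case: insub => [j|] /=; first exact: me.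
exact: (ideal0 (max_ideal_ideal R)).
Qed.

Notation ev := (mps_eval R_complete mx n).

Let residue_span t : exists b : nat -> R,
  t = lincomb (in_alg R) (fun _ : 'I_1 => 1) (fun=> residue t) + \sum_(0 <= i < n) x i * b i.
Proof.
have [b bE] := e_gen (max_ideal_residueB t); exists (extend_ord 0 b).
rewrite /lincomb big_ord1 mulr1 big_mkord.
under eq_bigr do rewrite /x !extend_ordE mulrC.
by rewrite -bE addrC subrK.
Qed.

(** R/(e_1, ..., e_n) is K, so [module_finite_parameters] applies with J = 0 and the single
    generator 1. *)
Lemma regular_eval_surj t : exists F, ev F = t.
Proof.
have [|s sP] := @module_finite_parameters _ _ R_complete R_noetherian x mx
    [set 0] n 1 (fun=> 1) (set10_ideal R) _ t; last first.
  exists (s ord0); apply/eqP; rewrite eq_sym -subr_eq0; apply/eqP.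
  by move: sP; rewrite /lincomb big_ord1 mulr1.
move=> t'; have [b bE] := residue_span t'; exists (fun=> residue t'), b.
by rewrite /= -addrA -opprD -bE subrr.
Qed.

(** Otherwise a system of n - 1 parameters would bound the dimension. *)
Lemma regular_eval_inj F : ev F = 0 -> F = 0.
Proof.
move=> F0; apply: contrapT => /eqP nF0; have [[P chainP] _] := R_dim.
have [Pprime _] := chainP; have [Pid P1 _] := Pprime 0%N isT.
have cof : cofinite (ideal_adjoin (P 0%N) x 0 n).
  exists 1%N, (fun=> 1) => t; have [b bE] := residue_span t.
  exists (fun=> residue t), b.
  by rewrite -addrA -opprD -bE subrr; apply: ideal0.
have PF : P 0%N (ev F) by rewrite F0; apply: ideal0.
have [n0 [x' mx' cof']] := cofinite_drop Pid P1 nF0 PF cof.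
have := prime_chain_cofinite R_complete R_noetherian chainP mx' cof'.
by rewrite -ltnS prednK // ltnn.
Qed.

(** The inverse of [ev], followed by evaluation at [a]. Injectivity of [ev] makes the chosen
    preimages [F] compatible with the operations. *)
Lemma regular_morphism (A : localAlg K) (A_complete : adically_complete A)
  (a : 'I_n -> A) : (forall i, max_ideal (a i)) ->
  exists rho : {lrmorphism R -> A}, forall i, rho (e i) = a i.
Proof.
move=> ma; pose y := extend_ord 0 a.
have my i : max_ideal (y i).
  rewrite /y /extend_ord; case: insub => [j|] /=; first exact: ma.
  exact: (ideal0 (max_ideal_ideal A)).
pose evA : {rmorphism mps n K -> A} := mps_eval A_complete my n.
have [F FP] := choice regular_eval_surj.
have Fu t G : ev G = t -> F t = G.
  move=> Gt; apply/eqP; rewrite -subr_eq0; apply/eqP; apply: regular_eval_inj.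
  by rewrite rmorphB FP Gt subrr.
have rhoB : zmod_morphism (evA \o F).
  by move=> s t /=; rewrite (Fu _ (F s - F t)) ?rmorphB ?FP.
have rhoM : monoid_morphism (evA \o F).
  split=> [|s t] /=; first by rewrite (Fu _ 1) ?rmorph1.
  by rewrite (Fu _ (F s * F t)) ?rmorphM ?FP.
have rhoZ : scalable (evA \o F).
  move=> c t /=; rewrite (Fu _ (mpsC n K c * F t)).
    by rewrite rmorphM [evA (mpsC _ _ _)]mps_evalC mulr_algl.
  by rewrite rmorphM mps_evalC FP mulr_algl.
pose rho := HB.pack_for {lrmorphism R -> A} (evA \o F)
  (GRing.isZmodMorphism.Build R A (evA \o F) rhoB)
  (GRing.isMonoidMorphism.Build R A (evA \o F) rhoM)
  (GRing.isScalable.Build K R A *:%R (evA \o F) rhoZ).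
exists rho => i; rewrite /= (Fu _ (mps_var n K i)).
  by rewrite [LHS]mps_eval_var // /y extend_ordE.
by rewrite mps_eval_var // /x extend_ordE.
Qed.

End RegularLocal.

(** * Newton's iteration *)

Section FirstOrder.
Variables (K : fieldType) (R : localAlg K) (A : artAlg K) (n : nat) (e : 'I_n -> R).
Hypothesis me : forall i, max_ideal (e i).
Hypothesis e_gen : forall a, max_ideal a -> exists b : 'I_n -> R, a = \sum_i b i * e i.
Notation m := (@max_ideal K A).
Variables (rho rho' : {lrmorphism R -> A}) (k : nat).
Hypothesis rhoE : forall j, ideal_exp m k (rho (e j) - rho' (e j)).

Let mid i : is_ideal (ideal_exp m i). Proof. exact: ideal_exp_ideal. Qed.

Lemma lrmorph_max (B : localAlg K) (f : {lrmorphism R -> B}) a :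
  max_ideal a -> max_ideal (f a).
Proof. by rewrite /max_ideal /= residue_lrmorph. Qed.

Let diffM (f g : {lrmorphism R -> A}) a b :
  f (a * b) - g (a * b) = (f a - g a) * f b + g a * (f b - g b).
Proof. by rewrite !rmorphM; ring. Qed.

(** Writing s as its residue plus a sum of b_j e_j, the difference at s is, modulo m^k, the sum of
    the rho(e_j) times the differences at b_j. Each round gains a factor in m, and m is
    nilpotent. *)
Lemma morphism_congr t : ideal_exp m k (rho t - rho' t).
Proof.
have [Q mQ] := @artinian_nilpotent K A.
suff H N s : exists w, ideal_exp m N w /\ ideal_exp m k (rho s - rho' s - w).
  by have [w [/mQ->]] := H Q t; rewrite subr0.
elim: N s => [|N IHN] s.
  exists (rho s - rho' s); split; first exact: ideal_exp0.
  by rewrite subrr; apply: (ideal0 (mid k)).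
have [b bE] := e_gen (max_ideal_residueB s).
have [w wP] := choice (fun j => IHN (b j)).
exists (\sum_j rho (e j) * w j); split.
  apply: (ideal_sum _ (mid _)) => j _; have [wN _] := wP j.
  by apply: ideal_exp_mulS => //; apply: lrmorph_max.
have -> : rho s - rho' s = \sum_j (rho (b j * e j) - rho' (b j * e j)).
  rewrite sumrB -!rmorph_sum -bE !rmorphB /= !rmorph_alg; ring.
rewrite -sumrB; apply: (ideal_sum _ (mid _)) => j _; have [_ wk] := wP j.
rewrite diffM [_ * w j]mulrC addrAC -mulrBl; apply: (idealD (mid k)).
  exact: (idealMr _ (mid k)).
exact: (idealMl _ (mid k)).
Qed.

(** Taylor expansion to first order: the remainder u lies in the square of the maximal ideal of R,
    and [diffM] expresses the difference at a product as terms with one factor in m and the other in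
    m^k. *)
Lemma morphism_first_order t (c : 'I_n -> K) : (0 < k)%N ->
  ideal_exp (@max_ideal K R) 2 (t - (residue t)%:A - \sum_j c j *: e j) ->
  ideal_exp m k.+1 (rho t - rho' t - \sum_j c j *: (rho (e j) - rho' (e j))).
Proof.
move=> k_gt0; set u := (t - _ - _ : R) => m2u.
have -> : rho t - rho' t - \sum_j c j *: (rho (e j) - rho' (e j)) = rho u - rho' u.
  rewrite /u !rmorphB /= !rmorph_alg !rmorph_sum.
  under [X in _ - X = _]eq_bigr do rewrite scalerBr.
  rewrite sumrB; under [X in _ - (X - _) = _]eq_bigr do rewrite -linearZ.
  under [X in _ - (_ - X) = _]eq_bigr do rewrite -linearZ.
  by ring.
have Lid : is_ideal [set a | max_ideal a /\ ideal_exp m k.+1 (rho a - rho' a)].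
  have mRid := max_ideal_ideal R.
  split=> /= [|a b [ma ka] [mb kb]|a b [mb kb]].
  - by split; [apply: ideal0|rewrite !rmorph0 subrr; apply: (ideal0 (mid _))].
  - by split; [apply: idealD|rewrite !rmorphD opprD addrACA; apply: (idealD (mid _))].
  split; first exact: idealMl.
  rewrite diffM; apply: (idealD (mid _)); last exact: (idealMl _ (mid _)).
  rewrite mulrC; apply: ideal_exp_mulS; [exact: lrmorph_max|exact: morphism_congr].
suff [] : [set a | max_ideal a /\ ideal_exp m k.+1 (rho a - rho' a)] u by [].
apply: (ideal_exp_ind Lid _ m2u) => a b ma; rewrite (ideal_exp1 (max_ideal_ideal R)) => mb.
split; first exact: (idealMl _ (max_ideal_ideal R)).
rewrite diffM; apply: (idealD (mid _)); last first.
  by apply: ideal_exp_mulS; [exact: lrmorph_max|exact: morphism_congr].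
by rewrite mulrC; apply: ideal_exp_mulS; [exact: lrmorph_max|exact: morphism_congr].
Qed.

End FirstOrder.

(** A point derivation kills constants and the square of the maximal ideal. *)
Lemma tangent_vector_expand (K : fieldType) (R : localAlg K) n (e : 'I_n -> R)
  (v : {linear R -> K^o}) t (c : 'I_n -> K) : tangent_vector v ->
  ideal_exp (@max_ideal K R) 2 (t - (residue t)%:A - \sum_j c j *: e j) ->
  v t = \sum_j v (e j) * c j.
Proof.
move=> vder; set u := (t - _ - _ : R) => m2u.
have mid := max_ideal_ideal R.
have Lid : is_ideal [set a | max_ideal a /\ v a = 0].
  split=> [|a b [ma va] [mb vb]|a b [mb vb]].
  - by split; [apply: ideal0|rewrite linear0].
  - by split; [apply: idealD|rewrite linearD /= va vb addr0].
  - by split; [apply: idealMl|rewrite vder vb mb mulr0 mul0r addr0].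
have v1 : v 1 = 0.
  have := vder 1 1; rewrite mulr1 rmorph1 mul1r => /eqP.
  by rewrite -subr_eq0 opprD addrA subrr sub0r oppr_eq0 => /eqP.
have [_ vu] : [set a | max_ideal a /\ v a = 0] u.
  apply: (ideal_exp_ind Lid _ m2u) => a b ma; rewrite (ideal_exp1 mid) => mb.
  by split; [apply: idealMl|rewrite vder ma mb !mul0r addr0].
move: vu; rewrite /u !linearB /= linearZ /= v1 linear_sum scaler0 subr0 => /eqP.
rewrite subr_eq0 => /eqP->; apply: eq_bigr => j _.
by rewrite linearZ /= mulrC.
Qed.

Lemma matrix_complete (K : fieldType) p n (W : 'M[K]_(p, n)) : row_free W ->
  exists r (C : 'M[K]_(r, n)) (M' : 'M[K]_(n, p + r)),
  [/\ n = (r + p)%N, col_mx W C *m M' = 1%:M & M' *m col_mx W C = 1%:M].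
Proof.
move=> Wfree; set C := row_base (W^C)%MS.
have rankW : \rank W = p by apply/eqP.
have nE : n = (\rank (W^C)%MS + p)%N.
  by rewrite mxrank_compl rankW subnK // -rankW rank_leq_col.
have MC_full : row_full (col_mx W C).
  rewrite -sub1mx -addsmxE (adds_eqmx (eqmx_refl W) (eq_row_base _)).
  by rewrite sub1mx addsmx_compl_full.
have MC_free : row_free (col_mx W C).
  by rewrite /row_free (eqP MC_full) {1}nE addnC.
exists (\rank (W^C)%MS), C, (pinvmx (col_mx W C)).
by split=> //; [apply: mulmxVp|apply: mulVpmx].
Qed.

Lemma coef_ps2CM (A : comNzRingType) (a : A) (F : ps2 A) p q :
  (ps2C a * F) p q = a * F p q.
Proof. by rewrite coef_fpsCM coef_fpsCM. Qed.

Section Solve.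
Variables (K : fieldType) (R : localAlg K).
Hypotheses (R_complete : adically_complete R) (R_noetherian : noetherian R).
Hypotheses (R_regular : regular_local R).
Variables (U : finType) (H : U -> ps2 R) (I : U -> set (ps2 K)).
Variables (d : U -> nat) (eps : forall u, 'I_(d u) -> ps2 K).
Arguments eps : clear implicits.
Hypotheses (Iid : forall u, is_ideal (I u)).
Hypothesis Ifree : forall u, free_quotient (mpsC 2 K) (I u) (eps u).
Hypothesis tangent_surj : forall a : U -> ps2 K,
  exists2 v : {linear R -> K^o}, tangent_vector v &
    forall u, I u (ps2_map (v : R -> K) (H u) - a u).

(** The equations (rho (H u) = v u mod J u, rho s = t) in the unknown rho have
    an invertible Jacobian matrix over K, so Newton's iteration solves them. *)
Lemma solve_morphism n : has_krull_dim R n ->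
  exists r (s : 'I_r -> R), [/\ n = (r + \sum_u d u)%N,
    forall q, max_ideal (s q) &
    forall (A : artAlg K) (J : U -> set (ps2 A)) (v : U -> ps2 A) (t : 'I_r -> A),
    (forall u, hilb2 (I u) (J u)) ->
    (forall u, I u (ps2_map (@residue K A) (v u) - closed_fiber (H u))) ->
    (forall q, max_ideal (t q)) ->
    let sol (rho : {lrmorphism R -> A}) :=
      (forall u, J u (ps2_map rho (H u) - v u)) /\ forall q, rho (s q) = t q in
    (exists rho, sol rho) /\ forall rho rho', sol rho -> sol rho' -> rho =1 rho'].
Proof.
move=> dimR; have [n' dimR' [e me e_cot]] := R_regular.
(* [regular_local] brings its own dimension; each of the two bounds the chains of the other. *)
have eqn : n' = n.
  apply/eqP; rewrite eqn_leq; apply/andP; split.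
    by have [[P /(proj2 dimR)]] := dimR'.
  by have [[P /(proj2 dimR')]] := dimR.
subst n'.
have e_gen : forall a, max_ideal a -> exists b : 'I_n -> R, a = \sum_i b i * e i.
  apply: max_ideal_cotangent => // a /e_cot[c [m2c _]]; by exists c.
have exD t : exists c : 'I_n -> K, ideal_exp (@max_ideal K R) 2
    (t - (residue t)%:A - \sum_j c j *: e j).
  by have [c [m2c _]] := e_cot _ (max_ideal_residueB t); exists c.
(* [D t] is the vector of partial derivatives of t at the closed point, with respect to the e_j. *)
have [D DP] := choice exD.
pose T := {u : U & 'I_(d u)}.
have cardT : #|{: T}| = (\sum_u d u)%N.
  by rewrite card_tagged sumnE big_map big_enum; apply: eq_bigr => u _; rewrite card_ord.
pose jac (x : T) j := coords (Ifree (tag x)) (ps2_map (D^~ j) (H (tag x))) (tagged x).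
pose W : 'M[K]_(#|{: T}|, n) := \matrix_(x, j) jac (enum_val x) j.
have jacE (v : {linear R -> K^o}) x : tangent_vector v ->
    coords (Ifree (tag x)) (ps2_map (v : R -> K) (H (tag x))) (tagged x) =
    \sum_j jac x j * v (e j).
  move=> vder; rewrite /jac; set u := tag x; set i := tagged x.
  have -> : ps2_map (v : R -> K) (H u) =
      \sum_j mpsC 2 K (v (e j)) * ps2_map (D^~ j) (H u).
    apply/fpsP => p; apply/fpsP => q; rewrite 2!coef_fps_sum.
    rewrite [LHS](tangent_vector_expand vder (DP _)); apply: eq_bigr => j _.
    exact: esym (coef_ps2CM _ (ps2_map (D^~ j) (H u)) p q).
  rewrite coords_sum //; apply: eq_bigr => j _.
  by rewrite coordsZ // mulrC.
(* A right inverse: its k-th column is the derivation that the hypothesis provides for the k-th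
   basis vector of the product of the quotients. *)
have Wfree : row_free W.
  have col k : exists w : 'cV[K]_n, W *m w = delta_mx k 0.
    pose a u := lincomb (mpsC 2 K) (eps u) (fun i => (enum_val k == Tagged _ i)%:R).
    have [v vder vP] := tangent_surj a; exists (\col_j v (e j)).
    apply/colP => x; rewrite !mxE eqxx andbT.
    under eq_bigr do rewrite !mxE; rewrite -jacE //.
    rewrite (coords_uniq _ (vP _)).
    rewrite (_ : Tagged _ (tagged (enum_val x)) = enum_val x); last by case: (enum_val x).
    by rewrite (inj_eq enum_val_inj) eq_sym.
  have [w wP] := choice col; apply/row_freeP; exists (\matrix_(j, k) w k j 0).
  apply/matrixP => x k; have /colP/(_ x) := wP k.
  rewrite !mxE eqxx andbT => <-; apply: eq_bigr => j _; by rewrite !mxE.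
have [r [C [M' [nE MM' M'M]]]] := matrix_complete Wfree.
(* Linear forms in the e_j, so that their Jacobian is exactly the complementary block [C]. *)
pose s q := \sum_j C q j *: e j.
exists r, s; split; first by rewrite -cardT.
  move=> q; apply: (ideal_sum _ (max_ideal_ideal R)) => j _.
  by rewrite -mulr_algl; apply: (idealMl _ (max_ideal_ideal R)).
move=> A J v t HJ vH mt sol.
pose m := @max_ideal K A; pose mk k := ideal_exp m k.
have mid k : is_ideal (mk k) by exact: ideal_exp_ideal.
have Jid u : is_ideal (J u) by have [] := HJ u.
have J_res u : mps_map 2 (@residue K A) @` J u = I u by have [] := HJ u.
pose Jfree u := hilb2_free (Iid u) (Ifree u) (HJ u).
pose ev (rho : {lrmorphism R -> A}) := \col_j rho (e j).
pose Psi (rho : {lrmorphism R -> A}) : 'cV[A]_(#|{: T}| + r) := col_mx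
  (\col_x let y := enum_val x in
     coords (Jfree (tag y)) (ps2_map rho (H (tag y)) - v (tag y)) (tagged y))
  (\col_q (rho (s q) - t q)).
have solP rho : sol rho <-> Psi rho = 0.
  split=> [[Jrho st]|/colP Psi0].
    apply/colP => i; rewrite [RHS]mxE; case: (split_ordP i) => x ->.
      by rewrite col_mxEu mxE /= coords_eq0.
    by rewrite col_mxEd mxE st subrr.
  split=> [u|q]; last first.
    by have := Psi0 (rshift _ q); rewrite col_mxEd !mxE => /eqP; rewrite subr_eq0 => /eqP.
  apply: (coords_eqP (Jfree := Jfree u)) => i.
  have := Psi0 (lshift r (enum_rank (Tagged (fun u => 'I_(d u)) i))).
  by rewrite col_mxEu !mxE enum_rankK.
pose MA := map_mx (in_alg A) (col_mx W C); pose MA' := map_mx (in_alg A) M'.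
have MA1 : MA *m MA' = 1%:M by rewrite -map_mxM MM' map_mx1.
have MA2 : MA' *m MA = 1%:M by rewrite -map_mxM M'M map_mx1.
have in_mul p q k (X : 'M[A]_(p, q)) (y : 'cV[A]_q) :
    (forall i, mk k (y i 0)) -> forall i, mk k ((X *m y) i 0).
  by move=> ky i; rewrite mxE; apply: (ideal_sum _ (mid k)) => j _; apply: (idealMl _ (mid k)).
(* For morphisms that agree modulo m^k, [Psi] is affine with constant matrix [MA] up to m^(k+1). *)
have Psi_lin rho rho' k : (0 < k)%N -> (forall j, mk k ((ev rho - ev rho') j 0)) ->
    forall i, mk k.+1 ((Psi rho - Psi rho' - MA *m (ev rho - ev rho')) i 0).
  move=> k_gt0 ev_k i.
  have {ev_k} delta_k j : mk k (rho (e j) - rho' (e j)) by have := ev_k j; rewrite !mxE.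
  have -> : (Psi rho - Psi rho' - MA *m (ev rho - ev rho')) i 0 = Psi rho i 0 - Psi rho' i 0
      - \sum_j MA i j * (rho (e j) - rho' (e j)).
    have entryE p q (y y' : 'cV[A]_p) (M : 'M[A]_(p, q)) z l :
        (y - y' - M *m z) l 0 = y l 0 - y' l 0 - \sum_j M l j * z j 0 by rewrite !mxE.
    by rewrite entryE; congr (_ - _); apply: eq_bigr => j _; rewrite !mxE.
  case: (split_ordP i) => x ->; last first.
    rewrite !col_mxEd !mxE (_ : _ - _ = 0); first exact: (ideal0 (mid _)).
    apply/eqP; rewrite subr_eq0 opprB addrA subrK /s !rmorph_sum -sumrB.
    apply/eqP; apply: eq_bigr => j _; rewrite mxE col_mxEd.
    by rewrite -mulr_algl !rmorphM /= !rmorph_alg mulrBr.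
  rewrite !col_mxEu !mxE -coordsB // opprB addrA subrK /=.
  under eq_bigr do rewrite mxE col_mxEu mxE.
  move: (enum_val x) => {x} [u x] /=.
  (* Two errors arise: the Taylor remainder [F], with coefficients in m^(k+1), and the gap between
     the coordinates of [G j] over A and [jac] over K. The gap lies in m and multiplies a difference
     in m^k. *)
  pose G j : ps2 A := ps2_map (fun t => (D t j)%:A) (H u).
  pose F := ps2_map rho (H u) - ps2_map rho' (H u)
            - \sum_j ps2C (rho (e j) - rho' (e j)) * G j.
  have F_k : @coefs_in 2 A (mk k.+1) F.
    move=> p q; have := morphism_first_order me e_gen delta_k k_gt0 (DP (H u p q)).
    congr (mk _ _); rewrite /F !coef_fpsB 2!coef_fps_sum; congr (_ - _).
    by apply: eq_bigr => j _; rewrite coef_ps2CM mulr_algr.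
  have -> : coords (Jfree u) (ps2_map rho (H u) - ps2_map rho' (H u)) x -
      \sum_j (jac (Tagged (fun u => 'I_(d u)) x) j)%:A * (rho (e j) - rho' (e j)) =
      coords (Jfree u) F x + \sum_j (rho (e j) - rho' (e j)) *
         (coords (Jfree u) (G j) x - (jac (Tagged (fun u => 'I_(d u)) x) j)%:A).
    rewrite /F [in RHS]coordsB // coords_sum // -addrA; congr (_ + _).
    under [X in _ = _ + X]eq_bigr do rewrite mulrBr.
    rewrite sumrB addrA; under [X in - X + _ - _]eq_bigr do rewrite coordsZ //.
    by rewrite addNr add0r; congr (- _); apply: eq_bigr => j _; rewrite mulrC.
  apply: (idealD (mid _)).
    apply: (coords_in_ideal (r := 2) (Iid u) (Ifree u) (Jid u) (J_res u)) F_k _.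
    exact: mid.
  apply: (ideal_sum _ (mid _)) => j _; rewrite mulrC.
  apply: ideal_exp_mulS; last exact: delta_k.
  suff <- : residue (coords (Jfree u) (G j) x) =
    jac (Tagged (fun u => 'I_(d u)) x) j by apply: max_ideal_residueB.
  rewrite (residue_coords (r := 2) (Ifree u) (J_res u) (Jfree u)) /jac /=.
  congr (fun_of_fin (coords _ _) _); apply/fpsP => p; apply/fpsP => q /=.
  exact: residueC.
have Psi_m rho i : mk 1%N (Psi rho i 0).
  rewrite /mk (ideal_exp1 (max_ideal_ideal A)); case: (split_ordP i) => x ->; last first.
    rewrite col_mxEd mxE; apply: (idealB (max_ideal_ideal A)) => //.
    apply: lrmorph_max; apply: (ideal_sum _ (max_ideal_ideal R)) => j _.
    by rewrite -mulr_algl; apply: (idealMl _ (max_ideal_ideal R)).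
  rewrite col_mxEu mxE /=; move: (enum_val x) => {x} [u x] /=.
  rewrite /max_ideal /= (residue_coords (r := 2) (Ifree u) (J_res u) (Jfree u)).
  apply: coords_eq0 => //; rewrite rmorphB.
  have -> : mps_map 2 (@residue K A) (ps2_map rho (H u)) = closed_fiber (H u).
    by apply/fpsP => p; apply/fpsP => q /=; apply: residue_lrmorph.
  exact: (idealBC (Iid u)).
have [Q mQ] := @artinian_nilpotent K A.
have m0 (p : nat) (y : 'cV[A]_p) : (forall i, mk Q (y i 0)) -> y = 0.
  by move=> yQ; apply/colP => i; rewrite [RHS]mxE; apply: (mQ _ (yQ i)).
split.
  suff [rho rhoQ] : exists rho, forall i, mk Q.+1 (Psi rho i 0).
    by exists rho; apply/solP/m0 => i; apply: (@ideal_expS _ m Q); apply: rhoQ.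
  elim: Q {mQ m0} => [|k [rho rhok]].
    (* Any starting point will do, since [Psi_m] puts every value of [Psi] in m; here all e_j go to
       0. *)
    have [|rho _] := @regular_morphism K R R_complete R_noetherian n e dimR me e_gen A
      (artinian_complete A) (fun=> 0); first by move=> _; apply: (ideal0 (max_ideal_ideal A)).
    by exists rho.
  (* Newton step with the fixed inverse [MA']: the linear part cancels [Psi rho], and what remains
     lies one power of m deeper. *)
  pose a := ev rho - MA' *m Psi rho.
  have ma j : max_ideal (a j 0).
    have -> : a j 0 = rho (e j) - (MA' *m Psi rho) j 0.
      by rewrite /a [LHS]mxE [X in X + _]mxE [X in _ + X]mxE.
    apply: (idealB (max_ideal_ideal A)); first exact: lrmorph_max.
    by rewrite -(ideal_exp1 (max_ideal_ideal A)); apply: (in_mul _ _ 1%N).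
  have [rho' rho'E] := regular_morphism R_complete R_noetherian dimR me e_gen
    (artinian_complete A) ma.
  have evE : ev rho' - ev rho = - (MA' *m Psi rho).
    apply/colP => j; rewrite !mxE rho'E !mxE; ring.
  exists rho' => i.
  have := Psi_lin rho' rho k.+1 isT _ i; rewrite evE mulmxN mulmxA MA1 mul1mx opprK subrK.
  by apply=> j; rewrite mxE; apply: (idealN (mid _)); apply: in_mul.
move=> rho rho' /solP P1 /solP P2.
(* Exponent 1 holds because the morphisms are local, and [Psi_lin] starts there. From then on [Psi]
   vanishes at both, so [MA] times the difference, and hence the difference, gains a power of m. *)
have ev_eq k : forall j, mk k ((ev rho - ev rho') j 0).
  elim: k => [|[|k] IHk] j; first exact: ideal_exp0.
    rewrite /mk (ideal_exp1 (max_ideal_ideal A)) !mxE.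
    by apply: (idealB (max_ideal_ideal A)); apply: lrmorph_max.
  rewrite -[ev rho - ev rho']mul1mx -MA2 -mulmxA; apply: in_mul => i.
  have := Psi_lin rho rho' k.+1 isT IHk i; rewrite P1 P2 subrr sub0r mxE.
  by move=> /(idealN (mid _)); rewrite opprK.
move=> a; apply: (complete_eq (artinian_complete A)) => k.
by apply: (morphism_congr me e_gen) => j; have := ev_eq k j; rewrite !mxE.
Qed.

End Solve.

(** * Smooth morphisms and contact equations *)

Section SmoothMorphisms.
Variables (K : fieldType) (X Y : ambient K).
Variables (F F' : formal_sub X) (G G' : formal_sub Y).
Variable L : forall A : artAlg K, pt X A -> pt Y A.
Arguments L : clear implicits.

Lemma artinian_lift (A B : artAlg K) (psi : {lrmorphism B -> A}) n (t : 'I_n -> A) :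
  (forall a, exists b, psi b = a) -> (forall i, max_ideal (t i)) ->
  exists2 t' : 'I_n -> B, forall i, max_ideal (t' i) & (fun i => psi (t' i)) = t.
Proof.
move=> psi_surj mt; have [t' tE] := choice (fun i => psi_surj (t i)).
exists t'; last exact/funext.
by move=> i; rewrite /max_ideal /= -(residue_lrmorph psi) tE; apply: mt.
Qed.

(** Two points with the same image and the same coordinates coincide, so it is
    enough to lift the coordinates. *)
Lemma coordinates_formally_smooth n : is_morphism F G L ->
  (forall (A B : artAlg K) (psi : {lrmorphism A -> B}),
     (forall b, exists a, psi a = b) ->
     forall p, F p -> F (base_change psi p)) ->
  has_relative_coordinates F G L n -> formally_smooth F G L.
Proof.
move=> [FG Lbc] Fbc [theta [m_theta theta_bc coord]] A B psi psi_surj p q Fp Gq qp.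
have [t mt tE] := artinian_lift psi_surj (m_theta A p Fp).
have [p' [[Fp' Lp' theta_p'] _]] := coord B q t Gq mt.
exists p' => //; split=> //.
have [p0 [_ p0_uniq]] := coord A (L A p) (theta A p) (FG _ _ Fp) (m_theta A p Fp).
rewrite -(p0_uniq p) //; apply/esym/p0_uniq; split; first exact: Fbc.
  by rewrite Lbc // Lp' qp.
by apply/funext => i; rewrite theta_bc // theta_p' -[in RHS]tE.
Qed.

(** F' is the pullback of G' along L, and each clause of smoothness is stable under this base
    change, with the same functions [theta]. *)
Lemma smooth_restrict n : (forall A p, F' p <-> F p /\ G' (L A p)) ->
  (forall A q, @G' A q -> G q) ->
  smooth_of_relative_dim F G L n -> smooth_of_relative_dim F' G' L n.
Proof.
move=> F'E G'G [[FG Lbc] smooth [theta [m_theta theta_bc coord]]].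
have F'F A p : @F' A p -> F p by move=> /F'E[].
split.
- by split=> [A p /F'E[]//|A B psi p /F'F]; apply: Lbc.
- move=> A B psi psi_surj p q /F'F Fp G'q qp.
  have [p' Fp' [pp' Lp']] := smooth A B psi psi_surj p q Fp (G'G _ _ G'q) qp.
  by exists p' => //; apply/F'E; rewrite Lp'.
exists theta; split=> [A p /F'F|A B psi p /F'F|A q t G'q mt].
- exact: m_theta.
- exact: theta_bc.
have [p [[Fp Lp pt] p_uniq]] := coord A q t (G'G _ _ G'q) mt.
exists p; split; first by split=> //; apply/F'E; rewrite Lp.
by move=> p1 [/F'F Fp1 Lp1 pt1]; apply: p_uniq.
Qed.

End SmoothMorphisms.

Lemma lrmorph_eq (K : fieldType) (R A : localAlg K) (f g : {lrmorphism R -> A}) :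
  f =1 g -> f = g.
Proof.
case: f g => [f [[fa] [fm] [fz]]] [g [[ga] [gm] [gz]]] /= /funext fg.
case: g / fg in ga gm gz *.
by rewrite (Prop_irrelevance fa ga) (Prop_irrelevance fm gm) (Prop_irrelevance fz gz).
Qed.

Section Surfaces.
Variables (A : comNzRingType) (J : set (ps2 A)).
Hypothesis Jid : is_ideal J.

Lemma graph_ideal_eqS (c : A) (h : ps2 A) n : (exists N, J ((h - ps2C c) ^+ N)) ->
  graph_ideal c h J (eqS c n) <-> J (coord2_y A * h + coord2_x A ^+ n.+1).
Proof.
move=> Jnil; rewrite -(graph_idealC Jid Jnil); have Gid := graph_ideal_ideal c h J.
apply: (ideal_cong Gid); rewrite rmorphD rmorphM rmorphXn opprD addrACA.
rewrite -mulrBr subrr addr0; apply: (idealMl _ Gid); exact: graph_ideal_z.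
Qed.

Lemma graph_ideal_eqS' (h : ps2 A) : (exists N, J (h ^+ N)) ->
  graph_ideal 0 h J (eqS' A) <-> J h.
Proof.
move=> [N JN]; have Jnil : exists N, J ((h - ps2C 0) ^+ N).
  by exists N; rewrite ps2CE rmorph0 subr0.
rewrite -(graph_idealC Jid Jnil); apply: (ideal_cong (graph_ideal_ideal _ _ _)).
exact: graph_ideal_z.
Qed.

End Surfaces.

Section ContactSlope.
Variables (K : fieldType) (R : localAlg K) (w : nat) (E : ps2 R).
Hypothesis E_contact : contact_equation w E.

Lemma contact_slope_const :
  mps_const 2 K (closed_fiber (contact_slope w E)) = contact_center w E.
Proof.
have [_ g_unit] := contact_decomposition E_contact; set g := contact_g w E in g_unit *.
have const0M (a b : fps R) : (a * b) 0%N = a 0%N * b 0%N by apply: (rmorphM (@fps_const R)).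
rewrite -[LHS]/(residue (contact_slope w E 0%N 0%N)) /contact_slope -/g coef_fpsCM const0M.
rewrite rmorphM /contact_center -/g; congr (_ * _).
have : g 0%N * g^-1 0%N = 1 by rewrite -const0M mulrV.
move=> /(congr1 (@residue K R)); rewrite rmorphM rmorph1 /= => g0.
have g00 : residue (g 0%N) != 0.
  by apply: contra_eq_neq g0 => ->; rewrite mul0r eq_sym oner_neq0.
by rewrite -[LHS](mulKf g00) g0 mulr1.
Qed.

Lemma contact_equation_slope (A : comNzRingType) (f : {rmorphism R -> A})
  (J : set (ps2 A)) : is_ideal J ->
  J (ps2_map f E) <->
  J (coord2_y A * ps2_map f (contact_slope w E) + coord2_x A ^+ w).
Proof.
move=> Jid; have [EE g_unit] := contact_decomposition E_contact.
set g := contact_g w E in EE g_unit; set h := contact_slope w E.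
have fE : contact_f E = fpsC g * h.
  by rewrite /h /contact_slope mulrA -rmorphM mulrV // rmorph1 mul1r.
clearbody h.
have mapE : ps2_map f E = fpsC (fps_map f g) *
    (coord2_y A * ps2_map f h + coord2_x A ^+ w).
  pose fm : {rmorphism ps2 R -> ps2 A} := mps_map 2 f.
  rewrite -[LHS]/(fm E) {1}EE fE rmorphD !rmorphM rmorphXn.
  have -> : fm (coord2_y R) = coord2_y A by apply: (fps_mapX (mps_map 1 f)).
  have -> : fm (coord2_x R) = coord2_x A.
    by rewrite [LHS](fps_mapC (mps_map 1 f)); congr fpsC; apply: fps_mapX.
  have -> : fm (fpsC g) = fpsC (fps_map f g) by apply: (fps_mapC (mps_map 1 f)).
  by rewrite mulrDr mulrCA [X in _ + X]mulrC.
have unitE : fpsC (fps_map f g^-1) * fpsC (fps_map f g) = 1 :> ps2 A.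
  by rewrite -!rmorphM mulVr // !rmorph1.
rewrite mapE; split; last exact: idealMl.
by move=> /(idealMl (fpsC (fps_map f g^-1)) Jid); rewrite mulrA unitE mul1r.
Qed.

End ContactSlope.

(** * The morphism L *)

Section MorphismL.
Variables (K : fieldType) (R : localAlg K).
Variables (k l : nat) (w : 'I_k -> nat) (E : 'I_k -> ps2 R) (E' : 'I_l -> ps2 R).
Hypothesis w_ge1 : forall i, (1 <= w i)%N.
Hypothesis E_contact : forall i, contact_equation (w i) (E i).
Hypothesis E'_origin : forall j, closed_fiber (E' j) 0%N 0%N = 0.
Variables (I : 'I_k -> set (ps2 K)) (I' : 'I_l -> set (ps2 K)).
Variables (d : 'I_k -> nat) (d' : 'I_l -> nat).
Hypotheses (I_ideal : forall i, is_ideal (I i)) (I'_ideal : forall j, is_ideal (I' j)).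
Hypotheses (I_length : forall i, colength (I i) (d i)).
Hypotheses (I'_length : forall j, colength (I' j) (d' j)).

(** The factors indexed by i and by j are treated together: each is given by the
    function of which L takes the graph. *)
Local Notation U := ('I_k + 'I_l)%type.

Definition factor_fun (u : U) : ps2 R :=
  match u with inl i => contact_slope (w i) (E i) | inr j => E' j end.
Definition factor_center (u : U) : K :=
  match u with inl i => contact_center (w i) (E i) | inr j => 0 end.
Definition factor_ideal (u : U) : set (ps2 K) :=
  match u with inl i => I i | inr j => I' j end.
Definition factor_length (u : U) : nat :=
  match u with inl i => d i | inr j => d' j end.
Definition factor_src (A : artAlg K) (p : source_pt R k l A) (u : U) : set (ps2 A) :=
  match u with inl i => src p i | inr j => src' p j end.
Definition factor_tgt (A : artAlg K) (q : target_pt k l A) (u : U) : set (ps3 A) :=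
  match u with inl i => tgt q i | inr j => tgt' q j end.

Local Notation H := factor_fun.
Local Notation c := factor_center.
Local Notation L := (morphL w E E').

Lemma factor_center_const u : mps_const 2 K (closed_fiber (H u)) = c u.
Proof. by case: u => [i|j]; [apply: contact_slope_const|apply: E'_origin]. Qed.

Lemma factor_ideal_ideal u : is_ideal (factor_ideal u).
Proof. by case: u. Qed.

Lemma factor_colength u : colength (factor_ideal u) (factor_length u).
Proof. by case: u. Qed.

Definition factor_basis u : 'I_(factor_length u) -> ps2 K :=
  sval (cid (factor_colength u)).

Lemma factor_free u : free_quotient (mpsC 2 K) (factor_ideal u) (@factor_basis u).
Proof. by rewrite /factor_basis; case: cid. Qed.

Lemma hilb_planesE (A : artAlg K) (p : source_pt R k l A) :
  hilb_planes R I I' A p <-> forall u, hilb2 (factor_ideal u) (factor_src p u).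
Proof.
split=> [[pI pI'] [i|j]|pU]; [exact: pI|exact: pI'|].
by split=> [i|j]; [apply: (pU (inl i))|apply: (pU (inr j))].
Qed.

Lemma hilb_spacesE (A : artAlg K) (q : target_pt k l A) :
  hilb_spaces w E E' I I' A q <->
  forall u, hilb3 (graph_ideal (c u) (closed_fiber (H u)) (factor_ideal u)) (factor_tgt q u).
Proof.
split=> [[pI pI'] [i|j]|pU]; [exact: pI|exact: pI'|].
by split=> [i|j]; [apply: (pU (inl i))|apply: (pU (inr j))].
Qed.

Lemma factor_tgt_morphL (A : artAlg K) (p : source_pt R k l A) u :
  factor_tgt (L A p) u = graph_ideal (c u)%:A (ps2_map (src_base p) (H u)) (factor_src p u).
Proof. by case: u => [i|j] //=; rewrite scale0r. Qed.

Lemma factor_src_inj (A : artAlg K) (p p' : source_pt R k l A) :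
  src_base p =1 src_base p' -> factor_src p =1 factor_src p' -> p = p'.
Proof.
case: p p' => [r s s'] [r1 s1 s1'] /= /lrmorph_eq-> sE.
by congr SourcePt; apply/funext => x; [apply: (sE (inl x))|apply: (sE (inr x))].
Qed.

Lemma factor_tgt_inj (A : artAlg K) (q q' : target_pt k l A) :
  factor_tgt q =1 factor_tgt q' -> q = q'.
Proof.
case: q q' => [s s'] [s1 s1'] /= sE.
by congr TargetPt; apply/funext => x; [apply: (sE (inl x))|apply: (sE (inr x))].
Qed.

Lemma closed_fiber_map (A : artAlg K) (f : {lrmorphism R -> A}) (F : ps2 R) :
  mps_map 2 (@residue K A) (ps2_map f F) = closed_fiber F.
Proof. by apply/fpsP => a; apply/fpsP => b /=; apply: residue_lrmorph. Qed.

Lemma factor_nilpotent (A : artAlg K) (f : {lrmorphism R -> A}) u (J : set (ps2 A)) :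
  hilb2 (factor_ideal u) J ->
  exists N, J ((ps2_map f (H u) - ps2C (c u)%:A) ^+ N).
Proof.
move=> HJ; apply: (hilb2_nilpotent (factor_ideal_ideal u) (factor_free u) HJ).
by apply: (center_max (factor_center_const u)); apply: closed_fiber_map.
Qed.

Lemma morphL_is_morphism : is_morphism (hilb_planes R I I') (hilb_spaces w E E' I I') L.
Proof.
split=> [A p /hilb_planesE Hp|A B psi p _].
  apply/hilb_spacesE => u; rewrite factor_tgt_morphL.
  apply: (hilb3_graph (factor_ideal_ideal u) (factor_free u) (factor_center_const u)) => //.
  exact: closed_fiber_map.
have mapE u : ps2_map (psi \o src_base p) (H u) = mps_map 2 psi (ps2_map (src_base p) (H u)).
  by [].
apply: factor_tgt_inj => u; rewrite factor_tgt_morphL /= mapE.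
have -> : factor_src (@base_change _ (source R k l) A B psi p) u
    = ideal_gen (mps_map 2 psi @` factor_src p u) by case: u.
have -> : factor_tgt (@base_change _ (target K k l) A B psi (L A p)) u
    = ideal_gen (mps_map 3 psi @` factor_tgt (L A p) u) by case: u.
by rewrite factor_tgt_morphL graph_ideal_base_change /= rmorph_alg.
Qed.

Lemma hilb_curvesE (A : artAlg K) (p : source_pt R k l A) :
  hilb_curves E E' I I' A p <->
  hilb_planes R I I' A p /\ hilb_surfaces w E E' I I' A (L A p).
Proof.
have nil (i : 'I_k) := @factor_nilpotent A (src_base p) (inl i).
have nil' (j : 'I_l) := @factor_nilpotent A (src_base p) (inr j).
have surfE i : hilb2 (I i) (src p i) ->
    src p i (ps2_map (src_base p) (E i)) <->
    tgt (L A p) i (eqS (contact_center (w i) (E i))%:A (w i).-1).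
  move=> Hi; have [Jid _ _] := Hi.
  (* The surface S_(w-1) has the exponent (w - 1) + 1, which is w because w is positive. *)
  have := graph_ideal_eqS Jid (w i).-1 (nil i _ Hi); rewrite prednK // => eqSE.
  by apply: (iff_trans _ (iff_sym eqSE)); apply: contact_equation_slope.
have surfE' j : hilb2 (I' j) (src' p j) ->
    src' p j (ps2_map (src_base p) (E' j)) <-> tgt' (L A p) j (eqS' A).
  move=> Hj; have [Jid _ _] := Hj.
  have Jnil : exists N, src' p j (ps2_map (src_base p) (E' j) ^+ N).
    have [N JN] := nil' j _ Hj; exists N.
    by move: JN; rewrite /factor_center scale0r ps2CE rmorph0 subr0.
  exact: iff_sym (graph_ideal_eqS' Jid Jnil).
split=> [[pI pI']|[Hp [qI qI']]].
  have Hp : hilb_planes R I I' A p by split=> [i|j]; [have [] := pI i|have [] := pI' j].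
  have [sI sI'] := morphL_is_morphism.1 A p Hp.
  split=> //; split=> [i|j]; split=> //.
    by have [Hi Ei] := pI i; apply/surfE.
  by have [Hj Ej] := pI' j; apply/surfE'.
have [HI HI'] := Hp; split=> [i|j]; split=> //.
  by apply/surfE => //; have [] := qI i.
by apply/surfE' => //; have [] := qI' j.
Qed.

Lemma hilb_planes_base_change (A B : artAlg K) (psi : {lrmorphism A -> B})
    (p : source_pt R k l A) : (forall b, exists a, psi a = b) ->
  hilb_planes R I I' A p ->
  hilb_planes R I I' B (@base_change _ (source R k l) A B psi p).
Proof.
move=> psi_surj /hilb_planesE Hp; apply/hilb_planesE => u.
have -> : factor_src (@base_change _ (source R k l) A B psi p) u
    = ideal_gen (ps2_map psi @` factor_src p u) by case: u.
exact: (hilb2_base_change (factor_ideal_ideal u) (factor_free u)).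
Qed.

Hypotheses (R_noetherian : noetherian R) (R_complete : adically_complete R).
Hypotheses (R_regular : regular_local R).
Hypothesis PhiDelta_surj : PhiDelta_surjective w E E' I I'.

Lemma factor_tangent_surj (a : U -> ps2 K) : exists2 v : {linear R -> K^o},
  tangent_vector v & forall u, factor_ideal u (ps2_map (v : R -> K) (H u) - a u).
Proof.
have [v vder [vI vI']] := PhiDelta_surj (fun i => a (inl i)) (fun j => a (inr j)).
by exists v => // -[i|j]; [apply: vI|apply: vI'].
Qed.

(** The coordinates are the values at lambda of the r complementary functions [s]. A target point
    fixes the ideals J and the classes of v modulo J, and [solve_morphism] then finds lambda. *)
Lemma morphL_coordinates n : has_krull_dim R n ->
  exists2 r, n = (r + (\sum_(i < k) d i + \sum_(j < l) d' j))%N &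
    has_relative_coordinates (hilb_planes R I I') (hilb_spaces w E E' I I') L r.
Proof.
move=> dimR.
have [r [s [nE ms solve]]] := solve_morphism R_complete R_noetherian R_regular
  factor_ideal_ideal factor_free factor_tangent_surj dimR.
exists r; first by rewrite nE big_sumType.
exists (fun A p q => src_base p (s q)); split=> [A p _ q|A B psi p _ q|A q t Hq mt] //.
  exact: lrmorph_max.
move/hilb_spacesE: Hq => Hq.
have Uid := factor_ideal_ideal; have Ufree := factor_free; have Uc := factor_center_const.
pose J u : set (ps2 A) := @fpsC (ps2 A) @^-1` factor_tgt q u.
have HJ u : hilb2 (factor_ideal u) (J u) := hilb3_slice (Uid u) (Ufree u) (Uc u) (Hq u).
have Jid u : is_ideal (J u) by have [] := HJ u.
have [v vP] := choice (fun u => hilb3_graphE (Uid u) (Ufree u) (Uc u) (Hq u)).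
have vH u : factor_ideal u (mps_map 2 (@residue K A) (v u) - closed_fiber (H u)).
  by have [] := vP u.
have [[rho [Jrho rho_t]] sol_uniq] := solve A J v t HJ vH mt.
pose p := SourcePt rho (fun i => J (inl i)) (fun j => J (inr j)).
have srcE u : factor_src p u = J u by case: u.
have graphE u f : J u (f - v u) ->
    graph_ideal (c u)%:A f (J u) = factor_tgt q u.
  move=> Jf; have [_ -> [N JN]] := vP u.
  apply: graph_ideal_congr => //; exact: idealBC.
exists p; split.
  split; first by apply/hilb_planesE => u; rewrite srcE.
    by apply: factor_tgt_inj => u; rewrite factor_tgt_morphL srcE; apply: graphE.
  by apply/funext.
move=> p' [/hilb_planesE Hp' Lp' theta_p'].
have tgtE u : graph_ideal (c u)%:A (ps2_map (src_base p') (H u)) (factor_src p' u)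
    = factor_tgt q u by rewrite -Lp' factor_tgt_morphL.
(* The contraction of a graph ideal to the plane is the ideal it was built from, so the source
   ideals are forced. *)
have src'E u : factor_src p' u = J u.
  apply/seteqP; rewrite /J -tgtE; have [Jid' _ _] := Hp' u.
  have srcP := graph_idealC Jid' (factor_nilpotent (src_base p') (Hp' u)).
  by split=> f => [Jf|/srcP//]; apply/srcP.
apply: factor_src_inj => [|u]; last by rewrite srcE src'E.
(* Modulo the target ideal z equals both v and the function attached to p', so the two agree modulo
   J. *)
apply: sol_uniq; split=> [u|i] //; last by rewrite -theta_p'.
have Qid : is_ideal (factor_tgt q u) by have [] := Hq u.
change (factor_tgt q u (fpsC (ps2_map (src_base p') (H u) - v u))); rewrite rmorphB.
have zq : factor_tgt q u (coord3_z (c u)%:A - fpsC (v u)).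
  by have [_ -> _] := vP u; apply: graph_ideal_z.
have zp : factor_tgt q u (coord3_z (c u)%:A - fpsC (ps2_map (src_base p') (H u))).
  by rewrite -tgtE; apply: graph_ideal_z.
exact: (idealBT Qid (idealBC Qid zp) zq).
Qed.

Lemma morphL_smooth n : has_krull_dim R n ->
  exists2 r, n = (r + (\sum_(i < k) d i + \sum_(j < l) d' j))%N &
    smooth_of_relative_dim (hilb_planes R I I') (hilb_spaces w E E' I I') L r /\
    smooth_of_relative_dim (hilb_curves E E' I I') (hilb_surfaces w E E' I I') L r.
Proof.
move=> /morphL_coordinates[r nE coord]; exists r => //.
have smooth : smooth_of_relative_dim (hilb_planes R I I') (hilb_spaces w E E' I I') L r.
  split=> //; first exact: morphL_is_morphism.
  apply: (coordinates_formally_smooth morphL_is_morphism _ coord) => A B psi psi_surj p.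
  exact: hilb_planes_base_change.
split=> //; apply: (smooth_restrict _ _ smooth) => [A p|A q [qI qI']].
  exact: hilb_curvesE.
by split=> [i|j]; [have [] := qI i|have [] := qI' j].
Qed.

End MorphismL.

Theorem theorem4p13 (RR : realType) (R : localAlg RR[i])
  (R_noetherian : noetherian R) (R_complete : adically_complete R)
  (k l : nat) (w : 'I_k -> nat) (E : 'I_k -> ps2 R) (E' : 'I_l -> ps2 R)
  (w_ge1 : forall i, (1 <= w i)%N)
  (E_contact : forall i, contact_equation (w i) (E i))
  (E'_origin : forall j, closed_fiber (E' j) 0%N 0%N = 0)
  (I : 'I_k -> set (ps2 RR[i])) (I' : 'I_l -> set (ps2 RR[i]))
  (d : 'I_k -> nat) (d' : 'I_l -> nat)
  (I_ideal : forall i, is_ideal (I i)) (I'_ideal : forall j, is_ideal (I' j))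
  (I_length : forall i, colength (I i) (d i))
  (I'_length : forall j, colength (I' j) (d' j))
  (I_curve : forall i, I i (closed_fiber (E i)))
  (I'_curve : forall j, I' j (closed_fiber (E' j))) :
  [/\ is_morphism (hilb_planes R I I') (hilb_spaces w E E' I I')
        (morphL w E E'),
      (forall A : artAlg RR[i],
         hilb_planes R I I' A `&`
           morphL w E E' A @^-1` hilb_surfaces w E E' I I' A
         = hilb_curves E E' I I' A) &
      (regular_local R -> PhiDelta_surjective w E E' I I' ->
       forall n, has_krull_dim R n ->
       exists2 r, n = (r + (\sum_(i < k) d i + \sum_(j < l) d' j))%N &
         smooth_of_relative_dim (hilb_planes R I I')
           (hilb_spaces w E E' I I') (morphL w E E') r /\
         smooth_of_relative_dim (hilb_curves E E' I I')
           (hilb_surfaces w E E' I I') (morphL w E E') r)].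

Proof.
split=> [|A|R_regular PhiDelta_surj n].
- exact: morphL_is_morphism.
- have curvesE := hilb_curvesE w_ge1 E_contact E'_origin I_ideal I'_ideal I_length I'_length.
  by apply/seteqP; split=> p /curvesE.
- exact: morphL_smooth.
Qed.
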